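(* Each instance $(N,A,(\succeq_i)_{i\in N},L)$ of gGASP in which each activity $a\in A^*$ is copyable and the graph $(N,L)$ is acyclic admits an individually stable feasible assignment; moreover, such an assignment can be found in time polynomial in $p$ and $n$.
   Context: An instance of the group activity selection problem with graph structure (gGASP) consists of: a finite set of players $N=\{1,\dots,n\}$; a finite set of activities $A=A^*\cup\{a_\emptyset\}$, where $A^*=\{a_1,\dots,a_p\}$ is the set of $p$ non-void activities and $a_\emptyset\notin A^*$ is the void activity; for each player $i$ a complete and transitive preference relation $\succeq_i$ on the set of alternatives $(A^*\times\{1,\dots,n\})\cup\{(a_\emptyset,1)\}$, with strict part $\succ_i$ and indifference part $\sim_i$; and a set $L$ of edges making $(N,L)$ an undirected graph (the social network). It is assumed that two alternatives can be compared under $\succeq_i$ in unit time. An assignment is a map $\pi:N\to A$. For $a\in A^*$ let $\pi^a=\{i\in N:\pi(i)=a\}$; let $\pi_i=\{j\in N:\pi(j)=\pi(i)\}$ if $\pi(i)\ne a_\emptyset$, and $\pi_i=\{i\}$ if $\pi(i)=a_\emptyset$. A coalition $S\subseteq N$ is feasible if it is connected in $(N,L)$; $\pi$ is feasible if $\pi_i$ is feasible for every $i\in N$. $\pi$ is individually rational if $(\pi(i),|\pi_i|)\succeq_i(a_\emptyset,1)$ for every $i\in N$. Given a feasible assignment $\pi$, player $i$ has a feasible NS-deviation to $a\in A^*$ with $a\neq\pi(i)$ if $\pi^a\cup\{i\}$ is connected in $(N,L)$ and $(a,|\pi^a|+1)\succ_i(\pi(i),|\pi_i|)$. It is a feasible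 IS-deviation if, in addition, $(a,|\pi^a|+1)\succeq_j(a,|\pi^a|)$ for all $j\in\pi^a$. A feasible assignment is individually stable if it is individually rational and no player has a feasible IS-deviation. Two non-void activities $a,b$ are equivalent if $(a,\ell)\sim_i(b,\ell)$ for every $i\in N$ and $\ell\in\{1,\dots,n\}$. A non-void activity $a$ is copyable if $A^*$ contains at least $n$ activities equivalent to $a$ (including $a$ itself). A graph is acyclic if it is a forest. *)

(* Defs.v *)
From mathcomp Require Import all_boot.

Set Implicit Arguments.
Unset Strict Implicit.
Unset Printing Implicit Defensive.

(** * Group activity selection on a social network *)

(* Players are ['I_n], non-void activities are ['I_p], and the void activity
   is [None].  An alternative is a pair (activity, group size). *)
Definition activity (p : nat) : Type := option 'I_p.

Definition alternative (n p : nat) : pred (activity p * nat) :=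
  [pred x | if x.1 is Some _ then 0 < x.2 <= n else x.2 == 1].
Arguments alternative : clear implicits.

(* [pref i x y] is the weak preference "x is at least as good as y for i".
   Its values outside [alternative n p] are never used. *)
Record gGASP (n p : nat) := GGASP {
  pref : 'I_n -> rel (activity p * nat);
  edge : rel 'I_n;
  pref_complete : forall i, {in alternative n p &, total (pref i)};
  pref_trans : forall i, {in alternative n p & &, transitive (pref i)};
  edge_sym : symmetric edge;
  edge_irr : irreflexive edge
}.

Definition assignment (n p : nat) : Type := {ffun 'I_n -> activity p}.

Section Stability.

Context {n p : nat} (G : gGASP n p).
Implicit Types (i j : 'I_n) (a b : 'I_p) (x y : activity p * nat).
Implicit Types (S : {set 'I_n}) (pi : assignment n p).

Definition strict i x y : bool := pref G i x y && ~~ pref G i y x.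
Definition indiff i x y : bool := pref G i x y && pref G i y x.

Definition connected_set S : Prop :=
  forall i j, i \in S -> j \in S ->
    connect [rel k l | [&& k \in S, l \in S & edge G k l]] i j.

Definition acyclic : Prop :=
  forall c : seq 'I_n, ucycle (edge G) c -> size c <= 2.

Definition participants pi a : {set 'I_n} := [set j | pi j == Some a].

Definition coalition pi i : {set 'I_n} :=
  if pi i is Some a then participants pi a else [set i].

Definition feasible pi : Prop := forall i, connected_set (coalition pi i).

Definition individually_rational pi : Prop :=
  forall i, pref G i (pi i, #|coalition pi i|) (None, 1).

Definition NS_deviation pi i a : Prop :=
  [/\ pi i <> Some a,
      connected_set (i |: participants pi a) &
      strict i (Some a, #|participants pi a|.+1) (pi i, #|coalition pi i|)].

Definition IS_deviation pi i a : Prop :=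
  NS_deviation pi i a /\
  forall j, j \in participants pi a ->
    pref G j (Some a, #|participants pi a|.+1) (Some a, #|participants pi a|).

Definition individually_stable pi : Prop :=
  individually_rational pi /\ ~ exists i a, IS_deviation pi i a.

(* [l : 'I_n] stands for the group size [l.+1]. *)
Definition equivalent a b : bool :=
  [forall i, [forall l : 'I_n, indiff i (Some a, l.+1) (Some b, l.+1)]].

Definition copyable a : bool := n <= #|[set b | equivalent a b]|.

End Stability.

(** * Machine model

   A unit-cost random access machine over the natural numbers, presented as a
   while-language.  A program uses a fixed finite collection of arrays, each
   named by a numeral and indexed by the naturals.  Arithmetic is limited to
   addition and truncated subtraction, so that a run of T steps only handles
   numbers of O(T + log(n + p)) bits and unit cost is polynomially related to
   Turing machine time.  The instance is read through n, p, single adjacency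
   tests, and single comparisons of two alternatives by a player, each taking
   unit time. *)

Inductive expr : Type :=
| Const of nat
| Players
| Activities
| Get of nat & expr
| Add of expr & expr
| Sub of expr & expr
| Adjacent of expr & expr
| Prefers of expr & expr & expr & expr & expr.

Inductive prog : Type :=
| Skip
| Put of nat & expr & expr
| Seq of prog & prog
| If of expr & prog & prog
| While of expr & prog.

Definition store : Type := nat -> nat -> nat.

Definition empty_store : store := fun _ _ => 0.

Definition update (s : store) (x k v : nat) : store :=
  fun y l => if (y == x) && (l == k) then v else s y l.

(* The void activity is coded by 0, and the activity [a : 'I_p] by [a.+1]. *)
Definition encode {p : nat} (a : activity p) : nat :=
  if a is Some b then b.+1 else 0.

Definition decode (p k : nat) : option (activity p) :=
  if k is l.+1 then omap Some (insub l : option 'I_p) else Some None.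

(* A query whose arguments do not denote players, resp. a player and two
   alternatives, is answered negatively. *)
Definition adjacent_query {n p : nat} (G : gGASP n p) (i j : nat) : bool :=
  match (insub i : option 'I_n), (insub j : option 'I_n) with
  | Some i', Some j' => edge G i' j'
  | _, _ => false
  end.

Definition prefers_query {n p : nat} (G : gGASP n p) (i a k b l : nat) : bool :=
  match (insub i : option 'I_n), decode p a, decode p b with
  | Some i', Some a', Some b' =>
      [&& alternative n p (a', k), alternative n p (b', l)
        & pref G i' (a', k) (b', l)]
  | _, _, _ => false
  end.

Fixpoint eval {n p : nat} (G : gGASP n p) (s : store) (e : expr) : nat :=
  match e with
  | Const k => k
  | Players => n
  | Activities => p
  | Get x e1 => s x (eval G s e1)
  | Add e1 e2 => eval G s e1 + eval G s e2
  | Sub e1 e2 => eval G s e1 - eval G s e2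
  | Adjacent e1 e2 => adjacent_query G (eval G s e1) (eval G s e2)
  | Prefers e1 e2 e3 e4 e5 =>
      prefers_query G (eval G s e1) (eval G s e2) (eval G s e3)
                      (eval G s e4) (eval G s e5)
  end.

Fixpoint cost (e : expr) : nat :=
  match e with
  | Const _ | Players | Activities => 1
  | Get _ e1 => (cost e1).+1
  | Add e1 e2 | Sub e1 e2 | Adjacent e1 e2 => (cost e1 + cost e2).+1
  | Prefers e1 e2 e3 e4 e5 =>
      (cost e1 + cost e2 + cost e3 + cost e4 + cost e5).+1
  end.

(* [exec G c s t s']: started in [s], program [c] halts in [s'] after exactly
   [t] steps.  Guards succeed when nonzero. *)
Inductive exec {n p : nat} (G : gGASP n p) :
  prog -> store -> nat -> store -> Prop :=
| ExecSkip s :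
    exec G Skip s 1 s
| ExecPut x e1 e2 s :
    exec G (Put x e1 e2) s (cost e1 + cost e2).+1
         (update s x (eval G s e1) (eval G s e2))
| ExecSeq c1 c2 s1 s2 s3 t1 t2 :
    exec G c1 s1 t1 s2 -> exec G c2 s2 t2 s3 ->
    exec G (Seq c1 c2) s1 (t1 + t2) s3
| ExecIfTrue e c1 c2 s s' t :
    eval G s e != 0 -> exec G c1 s t s' ->
    exec G (If e c1 c2) s (cost e + t).+1 s'
| ExecIfFalse e c1 c2 s s' t :
    eval G s e = 0 -> exec G c2 s t s' ->
    exec G (If e c1 c2) s (cost e + t).+1 s'
| ExecWhileFalse e c s :
    eval G s e = 0 ->
    exec G (While e c) s (cost e).+1 s
| ExecWhileTrue e c s1 s2 s3 t1 t2 :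
    eval G s1 e != 0 -> exec G c s1 t1 s2 -> exec G (While e c) s2 t2 s3 ->
    exec G (While e c) s1 (cost e + t1 + t2).+1 s3.

Lemma exec_det n p (G : gGASP n p) c s t1 s1 t2 s2 :
  exec G c s t1 s1 -> exec G c s t2 s2 -> t1 = t2 /\ s1 = s2.
Proof.
move=> H; elim: H t2 s2 => {c s t1 s1}.
- by move=> s t2 s2 H; inversion H.
- by move=> x e1 e2 s t2 s2 H; inversion H.
- move=> c1 c2 u1 u2 u3 t1 t2 _ H1 _ H2 t s H; inversion H; subst.
  match goal with K : exec G c1 _ _ _ |- _ => case: (H1 _ _ K) => ? ?; subst end.
  by match goal with K : exec G c2 _ _ _ |- _ => case: (H2 _ _ K) => ? ?; subst end.
- move=> e c1 c2 u u' t E _ H1 t2 s2 H; inversion H; subst; last by case/eqP: E.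
  by match goal with K : exec G c1 _ _ _ |- _ => case: (H1 _ _ K) => ? ?; subst end.
- move=> e c1 c2 u u' t E _ H1 t2 s2 H; inversion H; subst.
    by match goal with K : is_true (eval _ _ _ != 0) |- _ => case/eqP: K end.
  by match goal with K : exec G c2 _ _ _ |- _ => case: (H1 _ _ K) => ? ?; subst end.
- move=> e c s E t2 s2 H; inversion H; subst => //.
  by match goal with K : is_true (eval _ _ _ != 0) |- _ => case/eqP: K end.
- move=> e c u1 u2 u3 t1 t2 E _ H1 _ H2 t s H; inversion H; subst.
    by case/eqP: E.
  match goal with K : exec G c _ _ _ |- _ => case: (H1 _ _ K) => ? ?; subst end.
  by match goal with K : exec G (While e c) _ _ _ |- _ => case: (H2 _ _ K) => ? ?; subst end.
Qed.

(* By [exec_det], this says that the run of [c] on [G] halts after [t] steps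
   with [pi] written in array 0. *)
Definition computes {n p : nat} (G : gGASP n p) (c : prog) (t : nat)
    (pi : assignment n p) : Prop :=
  exists2 s, exec G c empty_store t s & forall i : 'I_n, s 0 i = encode (pi i).

(* Main.v *)
Require Import Defs.
From mathcomp Require Import all_boot zify.

Set Implicit Arguments.
Unset Strict Implicit.
Unset Printing Implicit Defensive.

(** Eliminate leaves of the forest one by one, the parent of [v] being the
   neighbour of [v] still present, and give each [v] a coalition [S v] inside its
   subtree together with an activity [A v].  First [v] takes its best option among
   the void activity, an activity on its own, and joining [S k] for a child [k] all
   of whose members accept a newcomer; then, as long as all members accept,
   children of members who strictly gain by joining are added one at a time.
   Members never lose, so each [w] in [S v] likes [S v] at least as much as the
   [S w] it had formed itself.  Going back from the last eliminated vertex, [v]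
   stays in its parent's block if that block's coalition contains [v], and
   otherwise starts the block [S v].  A deviation along an edge of the forest then
   contradicts either the choice made by the deviating parent or the maximality of
   the coalition above the deviating child.  Since activities are copyable, the
   [n] coalitions can be played with pairwise distinct copies. *)

(** * Leaves in forests *)

Section Forest.

Context {n p : nat} (G : gGASP n p).

(** An isolated remaining vertex qualifies as well; it becomes the root of its tree. *)
Definition leaf (D : {set 'I_n}) (u : 'I_n) : Prop :=
  u \notin D /\
  forall w1 w2, w1 \notin D -> w2 \notin D -> edge G u w1 -> edge G u w2 ->
    w1 = w2.

(** The edge would close the cycle formed by [x], [y], [s1] and [w], which has at least three
    vertices. *)
Lemma acyclic_no_chord x y (s1 s2 : seq 'I_n) w :
  acyclic G -> path (edge G) x (y :: s1 ++ w :: s2) ->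
  uniq [:: x, y & s1 ++ w :: s2] -> ~~ edge G x w.
Proof.
move=> acG pth unq; apply/negP=> exw.
suff /acG : ucycle (edge G) [:: x, y & rcons s1 w].
  by rewrite /= size_rcons.
apply/andP; split.
  rewrite /= rcons_path last_rcons (edge_sym G w) exw andbT.
  by move: pth; rewrite /= -cat_rcons cat_path => /and3P[-> ->].
by move: unq; rewrite -cat_rcons -!cat_cons cat_uniq => /andP[].
Qed.

(** Otherwise every remaining vertex has two remaining neighbours, and a simple path can be
    prolonged at its first vertex forever: one of the two is not the second vertex of the path, and
    by [acyclic_no_chord] it does not lie further along either. But no simple path has more than [n]
    vertices. *)
Lemma leaf_exists (D : {set 'I_n}) :
  acyclic G -> D != setT -> exists u, leaf D u.
Proof.
move=> acG; rewrite -subTset => /subsetPn[x0 _ x0D].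
pose two u w1 w2 := [&& w1 \notin D, w2 \notin D, edge G u w1, edge G u w2 & w1 != w2].
case: (boolP [exists u, (u \notin D) && ~~ [exists w1, exists w2, two u w1 w2]]).
  case/existsP=> u /andP[uD no]; exists u; split=> // w1 w2 d1 d2 e1 e2.
  apply/eqP/negPn/negP=> ne; case/negP: no; apply/existsP; exists w1.
  by apply/existsP; exists w2; apply/and5P.
move/existsPn=> all2.
suff long m : exists x s, [/\ size s = m, path (edge G) x s, uniq (x :: s) & x \notin D].
  have [x [s [sz _ /card_uniqP card_s _]]] := long n.
  by have := max_card (mem (x :: s)); rewrite card_s card_ord /= sz ltnn.
elim: m => [|m [x [s [sz pth unq xD]]]]; first by exists x0, [::].
have := all2 x; rewrite xD negbK => /existsP[w1 /existsP[w2 /and5P[d1 d2 e1 e2 ne]]].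
have [w [wD exw wh]] : exists w, [/\ w \notin D, edge G x w & ohead s != Some w].
  case: (eqVneq (ohead s) (Some w1)) => [-> |]; last by exists w1.
  by exists w2; split=> //; apply: contraNneq ne => -[->].
exists w, (x :: s); split=> //.
- by rewrite /= sz.
- by rewrite /= (edge_sym G w) exw.
rewrite cons_uniq unq andbT inE negb_or; apply/andP; split.
  by apply: contraTneq exw => ->; rewrite edge_irr.
case: s sz pth unq wh => [|y s] // _ pth unq wh.
rewrite inE negb_or; apply/andP; split; first by apply: contra wh => /eqP->.
apply/negP=> ws; case/splitPr: ws pth unq => s1 s2 pth unq.
by have := acyclic_no_chord acG pth unq; rewrite exw.
Qed.

End Forest.

(** * Preference queries *)

Section Queries.

Context {n p : nat} (G : gGASP n p).

Definition valid (a k : nat) : bool :=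
  if decode p a is Some a' then alternative n p (a', k) else false.

Lemma validE a k : valid a k = if a is 0 then k == 1 else (a <= p) && (0 < k <= n).
Proof.
case: a => [|a] //; rewrite /valid /=.
by case: insubP => [u -> _|/negbTE->].
Qed.

Lemma decode_encode (a : activity p) : decode p (encode a) = Some a.
Proof. by case: a => [a|] //=; rewrite valK. Qed.

Lemma adjacent_queryE (i j : 'I_n) : adjacent_query G i j = edge G i j.
Proof. by rewrite /adjacent_query !valK. Qed.

Lemma prefers_queryE (i : 'I_n) a k b l :
  prefers_query G i (encode a) k (encode b) l =
  [&& alternative n p (a, k), alternative n p (b, l) & pref G i (a, k) (b, l)].
Proof. by rewrite /prefers_query valK !decode_encode. Qed.

Lemma prefers_valid i a k b l :
  prefers_query G i a k b l -> valid a k && valid b l.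
Proof.
rewrite /prefers_query /valid; case: insubP => // u _ _.
by case: (decode p a) => // a'; case: (decode p b) => // b' /and3P[-> ->].
Qed.

(** A positive answer certifies that both arguments are alternatives, so transitivity passes to raw
    numerals; totality, by contrast, asks for [valid] on both sides. *)
Lemma prefers_trans i b l a k c m :
  prefers_query G i a k b l -> prefers_query G i b l c m ->
  prefers_query G i a k c m.
Proof.
rewrite /prefers_query; case: insubP => // u _ _.
case: (decode p a) => // a'; case: (decode p b) => // b'.
case: (decode p c) => // c' /and3P[v1 v2 p1] /and3P[_ v3 p2].
by rewrite v1 v3; apply: pref_trans p1 p2.
Qed.

Lemma prefers_total (i : 'I_n) a k b l : valid a k -> valid b l ->
  prefers_query G i a k b l || prefers_query G i b l a k.
Proof.
rewrite /prefers_query /valid valK.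
case: (decode p a) => // a'; case: (decode p b) => // b' va vb.
by rewrite va vb; apply: pref_complete.
Qed.

Lemma prefers_refl (i : 'I_n) a k : valid a k -> prefers_query G i a k a k.
Proof. by move=> va; have := prefers_total i va va; rewrite orbb. Qed.

(** A size outside [1..n] makes both queries fail; otherwise indifference at that size and
    transitivity exchange [a] and [b]. The two equations serve as one rewrite rule. *)
Lemma equivalent_prefers (a b : 'I_p) i c k l : equivalent G a b ->
  (prefers_query G i a.+1 k c l = prefers_query G i b.+1 k c l) *
  (prefers_query G i c l a.+1 k = prefers_query G i c l b.+1 k).
Proof.
move=> /forallP eq_ab; rewrite /prefers_query; case: insubP => // u _ _.
have dE (x : 'I_p) : decode p x.+1 = Some (Some x) by exact: decode_encode (Some x).
rewrite !dE; case: (decode p c) => // c'; rewrite !/(alternative n p (Some _, k)) /=.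
case: (boolP (0 < k <= n)) => //= k_bnd; case: (boolP (alternative _ _ (c', l))) => //= vc.
have [vab vba] : pref G u (Some a, k) (Some b, k) /\ pref G u (Some b, k) (Some a, k).
  case: k k_bnd => // k /= kn.
  by have /forallP/(_ (Ordinal kn))/andP[] := eq_ab u.
by split; apply/idP/idP => h;
  do [exact: pref_trans vba h | exact: pref_trans vab h
     | exact: pref_trans h vab | exact: pref_trans h vba].
Qed.

End Queries.

Arguments valid : clear implicits.

(** * Certificates of stability *)

Section Certificate.

Context {n p : nat} (G : gGASP n p).
Implicit Types (D T : {set 'I_n}) (P A rk : 'I_n -> nat) (S : 'I_n -> {set 'I_n}).

Local Notation q := (prefers_query G).

(* Always false for the void activity [0], whose group size cannot be 2: an
   idle player is never joined. *)
Definition accepts (a : nat) T : bool :=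
  [forall j, (j \in T) ==> q j a #|T|.+1 a #|T|].

(* [D] is the set of eliminated vertices, [P v] is [0] or the parent of [v] plus
   one, and [T] with activity [a] is a candidate for [S v]. *)
Record anchored D P A S (v : 'I_n) T (a : nat) : Prop := Anchored {
  anchored_in : v \in T;
  anchored_par : forall w, w \in T -> w != v ->
    w \in D /\ exists2 u, u \in T & P w = u.+1;
  anchored_mem : forall w, w \in T -> w != v -> q w a #|T| (A w) #|S w|;
  anchored_alone : forall b, b <= p -> q v a #|T| b 1;
  anchored_child : forall k : 'I_n, k \in D -> P k = v.+1 -> accepts (A k) (S k) ->
    q v a #|T| (A k) #|S k|.+1
}.

(** No child of a member gains strictly by joining: since queries fail on illegal alternatives, this
    is phrased as weak preference in one direction forcing it in the other. It is vacuous if some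
    member refuses newcomers. *)
Definition saturated D P A S T (a : nat) : Prop :=
  forall j w : 'I_n, j \in D -> P j = w.+1 -> w \in T -> j \notin T -> accepts a T ->
    q j a #|T|.+1 (A j) #|S j| -> q j (A j) #|S j| a #|T|.+1.

(** By [cert_adj] every edge at an eliminated vertex joins a child and its parent. The rank, later
    the round of elimination, increases towards the parent. *)
Record cert D rk P A S : Prop := Cert {
  cert_bound : forall v, v \in D -> P v <= n;
  cert_edge : forall v u : 'I_n, v \in D -> P v = u.+1 -> edge G v u;
  cert_adj : forall v u : 'I_n, v \in D -> edge G v u ->
    P v = u.+1 \/ u \in D /\ P u = v.+1;
  cert_rank : forall v u : 'I_n, v \in D -> u \in D -> P v = u.+1 -> rk v < rk u;
  cert_anchored : forall v, v \in D -> anchored D P A S v (S v) (A v);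
  cert_saturated : forall v, v \in D -> saturated D P A S (S v) (A v)
}.

Lemma accepts_prefers a T j : accepts a T -> j \in T -> q j a #|T|.+1 a #|T|.
Proof. by move/forallP/(_ j)/implyP; apply. Qed.

Lemma anchored_valid D P A S v T a : anchored D P A S v T a -> valid n p a #|T|.
Proof. by move/anchored_alone/(_ 0 isT)/prefers_valid/andP=> []. Qed.

Lemma cert_mem D rk P A S v w : cert D rk P A S -> v \in D -> w \in S v ->
  q w (A v) #|S v| (A w) #|S w|.
Proof.
move=> ce vD wS; have an := cert_anchored ce vD.
case: (eqVneq w v) => [->|ne]; last exact: (anchored_mem an _ _).
exact/prefers_refl/(anchored_valid an).
Qed.

Lemma cert_sub D rk P A S v : cert D rk P A S -> v \in D -> S v \subset D.
Proof.
move=> ce vD; apply/subsetP=> w wS; case: (eqVneq w v) => [->//|ne].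
by have [] := anchored_par (cert_anchored ce vD) wS ne.
Qed.

(** Acceptance says that no old member loses, so by transitivity all earlier comparisons survive the
    arrival of [j]; the comparison for [j] itself is the last premise. *)
Lemma anchored_grow D P A S v T a j (w : 'I_n) : anchored D P A S v T a ->
  accepts a T -> j \in D -> P j = w.+1 -> w \in T -> j \notin T ->
  q j a #|T|.+1 (A j) #|S j| -> anchored D P A S v (j |: T) a.
Proof.
move=> an acc jD Pj wT jT qj.
have cT : #|j |: T| = #|T|.+1 by rewrite cardsU1 jT.
have vT := anchored_in an; have qv := accepts_prefers acc vT.
split.
- by rewrite inE vT orbT.
- move=> x; rewrite inE in_set1 => /orP[/eqP-> _ | xT xv].
    by split=> //; exists w => //; rewrite inE wT orbT.
  have [xD [u uT Px]] := anchored_par an xT xv.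
  by split=> //; exists u => //; rewrite inE uT orbT.
- move=> x; rewrite inE in_set1 cT => /orP[/eqP-> _ // | xT xv].
  exact: prefers_trans (accepts_prefers acc xT) (anchored_mem an xT xv).
- by move=> b bp; rewrite cT; apply: prefers_trans qv (anchored_alone an bp).
- move=> k kD Pk acck; rewrite cT.
  exact: prefers_trans qv (anchored_child an kD Pk acck).
Qed.

Lemma anchored_single D P A S (v : 'I_n) a :
  (forall b, b <= p -> q v a 1 b 1) ->
  (forall k : 'I_n, k \in D -> P k = v.+1 -> accepts (A k) (S k) ->
     q v a 1 (A k) #|S k|.+1) ->
  anchored D P A S v [set v] a.
Proof.
by move=> al ch; split=> [||||]; rewrite ?cards1 ?set11 // => w /set1P-> /eqP.
Qed.

(** Chains of parents inside [S k] end at [k], whose parent [v] now belongs to the set; members of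
    [S k] compare through the smaller coalition, as they accept a newcomer. *)
Lemma anchored_join D rk P A S (v k : 'I_n) : cert D rk P A S -> v \notin D ->
  k \in D -> P k = v.+1 -> accepts (A k) (S k) ->
  (forall b, b <= p -> q v (A k) #|S k|.+1 b 1) ->
  (forall k' : 'I_n, k' \in D -> P k' = v.+1 -> accepts (A k') (S k') ->
     q v (A k) #|S k|.+1 (A k') #|S k'|.+1) ->
  anchored D P A S v (v |: S k) (A k).
Proof.
move=> ce vD kD Pk acc al ch.
have /subsetP SD := cert_sub ce kD.
have vS : v \notin S k by apply: contra vD; apply: SD.
have cT : #|v |: S k| = #|S k|.+1 by rewrite cardsU1 vS.
split; rewrite ?cT ?setU11 //.
- move=> w /setU1P[-> /eqP // | wS] wv.
  split; first exact: SD.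
  case: (eqVneq w k) => [->|wk]; first by exists v => //; rewrite setU11.
  have [_ [u uS Pw]] := anchored_par (cert_anchored ce kD) wS wk.
  by exists u => //; rewrite inE uS orbT.
- move=> w /setU1P[-> /eqP // | wS] wv.
  exact: prefers_trans (accepts_prefers acc wS) (cert_mem ce kD wS).
Qed.

(** The parent of [v] lies outside [D] and differs from [v], so no vertex of [v |: D] gets [v] as a
    child: conditions on children range over the same vertices as before. *)
Lemma cert_extend D rk P A S rk' P' A' S' (v : 'I_n) :
  cert D rk P A S -> v \notin D ->
  {in D, rk' =1 rk} -> {in D, P' =1 P} -> {in D, A' =1 A} -> {in D, S' =1 S} ->
  (forall w, w \in D -> rk w < rk' v) ->
  P' v <= n ->
  (forall u : 'I_n, P' v = u.+1 -> u \notin D /\ edge G v u) ->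
  (forall u : 'I_n, u \notin D -> edge G v u -> P' v = u.+1) ->
  anchored D P A S v (S' v) (A' v) -> saturated D P A S (S' v) (A' v) ->
  cert (v |: D) rk' P' A' S'.
Proof.
move=> ce vD Erk EP EA ES rkv Pv_le Pv_edge Pv_par an sat.
have DvD w : w \in D -> w \in v |: D by move=> wD; rewrite inE wD orbT.
have parv u w : u \in v |: D -> w \in v |: D -> P' w = u.+1 -> w \in D /\ P w = u.+1.
  move=> uvD /setU1P[-> /Pv_edge [uD evu] | wD]; last by rewrite EP.
  by move: uvD; rewrite inE (negbTE uD) orbF => /set1P uv; rewrite uv edge_irr in evu.
have anE w T a : w \in v |: D -> anchored D P A S w T a -> anchored (v |: D) P' A' S' w T a.
  move=> wvD [in1 par mem alone child]; split=> //.
  - move=> x xT xw; have [xD [u uT Px]] := par x xT xw.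
    by split; [exact: DvD | exists u; rewrite ?EP].
  - by move=> x xT xw; have [xD _] := par x xT xw; rewrite EA ?ES ?mem.
  - move=> k kvD Pk; have [kD Pk'] := parv _ _ wvD kvD Pk.
    by rewrite EA ?ES //; apply: child.
have satE w T a : w \in v |: D -> anchored D P A S w T a ->
    saturated D P A S T a -> saturated (v |: D) P' A' S' T a.
  move=> wvD anw sw j x jvD Pj xT.
  have xvD : x \in v |: D.
    case: (eqVneq x w) => [->//|xw]; apply: DvD.
    by have [] := anchored_par anw xT xw.
  by have [jD Pj'] := parv _ _ xvD jvD Pj; rewrite EA ?ES //; apply: sw Pj' xT.
split.
- by move=> w /setU1P[-> // | wD]; rewrite EP // (cert_bound ce).
- move=> w u /setU1P[-> /Pv_edge [] // | wD]; rewrite EP //; exact: (cert_edge ce).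
- move=> w u /setU1P[-> evu | wD ewu]; last first.
    rewrite EP //; case: (cert_adj ce wD ewu) => [|[uD Pu]]; first by left.
    by right; rewrite EP // DvD.
  case: (boolP (u \in D)) => uD; last by left; apply: Pv_par.
  right; split; first exact: DvD.
  (* Seen from [u], the vertex [v] must be the parent, for a child of [u] would lie in [D]. *)
  case: (cert_adj ce uD (u := v)); first by rewrite edge_sym.
    by rewrite EP.
  by case=> vD'; rewrite vD' in vD.
- move=> w u /setU1P[-> uvD /Pv_edge[uD evu] | wD].
    by move: uvD; rewrite inE (negbTE uD) orbF => /set1P uv; rewrite uv edge_irr in evu.
  case/setU1P=> [-> _|uD]; first by rewrite Erk // rkv.
  by rewrite EP ?Erk //; apply: (cert_rank ce).
- move=> w wvD; apply: anE => //; case/setU1P: (wvD) => [->//|wD].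
  by rewrite EA ?ES //; apply: (cert_anchored ce wD).
- move=> w wvD; case/setU1P: (wvD) => [wv|wD].
    by rewrite wv in wvD *; apply: satE wvD an sat.
  rewrite EA ?ES //; apply: satE wvD _ _; first exact: (cert_anchored ce wD).
  exact: (cert_saturated ce wD).
Qed.

(** The maps are read off stores, whose arrays are only compared cell by cell. *)
Lemma cert_ext D rk P A S rk' P' A' S' : cert D rk P A S ->
  rk' =1 rk -> P' =1 P -> A' =1 A -> S' =1 S -> cert D rk' P' A' S'.
Proof.
case=> bd ed adj rnk an sat Erk EP EA ES.
split=> [v|v u|v u|v u|v vD|v vD]; rewrite ?EP ?Erk ?EA ?ES; try by eauto.
  have [in1 par mem alone child] := an v vD.
  split=> // [w wT wv|w wT wv|k]; rewrite ?EP ?EA ?ES //; last exact: child.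
    by have [wD [u uT Pw]] := par w wT wv; split=> //; exists u; rewrite // EP.
  exact: mem.
by move=> j w; rewrite EP EA ES; apply: sat.
Qed.

Lemma accepts_ext a b T :
  (forall i c k l, (q i a k c l = q i b k c l) * (q i c l a k = q i c l b k)) ->
  accepts a T = accepts b T.
Proof. by move=> ab; apply: eq_forallb => j; rewrite !ab. Qed.

(** A certificate uses activities only through queries, so copies may be substituted. *)
Lemma cert_relabel D rk P A A' S :
  (forall v i c k l, (q i (A v) k c l = q i (A' v) k c l) *
                     (q i c l (A v) k = q i c l (A' v) k)) ->
  cert D rk P A S -> cert D rk P A' S.
Proof.
move=> AA' [bd ed adj rnk an sat].
have accE v T : accepts (A' v) T = accepts (A v) T.
  by apply: accepts_ext => *; rewrite !AA'.
split=> // v vD; last first.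
  move=> j w jD Pj wT jT; rewrite accE => acc.
  by have := sat v vD j w jD Pj wT jT acc; rewrite !AA'.
have [in1 par mem alone child] := an v vD; split=> //.
- by move=> w wT wv; rewrite -!AA'; apply: mem.
- by move=> b bp; rewrite -AA'; apply: alone.
- by move=> k kD Pk; rewrite accE -!AA'; apply: child.
Qed.

(** * From a certificate to a stable assignment *)

Section Stable.

(** [H v] is the head of the block of [v], whose members will be [S (H v)]; [L] gives the labels,
    pairwise distinct unless void. *)
Variables (rk P : 'I_n -> nat) (S : 'I_n -> {set 'I_n}) (L : 'I_n -> activity p).
Variables (H : 'I_n -> 'I_n) (pi : assignment n p).
Hypothesis ce : cert setT rk P (fun v => encode (L v)) S.
Hypothesis L_inj : forall v w a, L v = Some a -> L w = Some a -> v = w.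
Hypothesis H_par : forall v u : 'I_n, P v = u.+1 ->
  H v = if v \in S (H u) then H u else v.
Hypothesis H_root : forall v, P v = 0 -> H v = v.
Hypothesis piE : forall v, pi v = L (H v).

Lemma parentP (v : 'I_n) : P v = 0 \/ exists u : 'I_n, P v = u.+1.
Proof.
have := cert_bound ce (in_setT v); case: (P v) => [|m] mn; first by left.
by right; exists (Ordinal mn).
Qed.

(** Induction from the roots downwards: ranks grow towards the parent and are bounded by their
    maximum. *)
Lemma rank_ind (Q : 'I_n -> Prop) :
  (forall v, (forall u : 'I_n, P v = u.+1 -> Q u) -> Q v) -> forall v, Q v.
Proof.
move=> IH v; pose M := \max_(w < n) rk w.
have [m] := ubnP (M - rk v); elim: m v => // m IHm v lt_m.
apply: IH => u Pv; apply: IHm.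
have := cert_rank ce (in_setT v) (in_setT u) Pv.
have : rk u <= M by apply: (leq_bigmax u).
lia.
Qed.

Lemma head_mem v : v \in S (H v).
Proof.
have vS := anchored_in (cert_anchored ce (in_setT v)).
case: (parentP v) => [/H_root->// | [u /H_par->]].
by case: ifP.
Qed.

Lemma head_idem v : H (H v) = H v.
Proof.
elim/rank_ind: v => v IH; case: (parentP v) => [P0|[u Pv]].
  by rewrite !(H_root P0).
rewrite (H_par Pv); case: ifP => vS; first exact: IH.
by rewrite (H_par Pv) vS.
Qed.

(** From left to right this is [head_mem]. Conversely the parent of a member other than [h] is again
    a member, so by induction its head is [h], and the membership test of [H_par] then succeeds. *)
Lemma head_set h w : H h = h -> (H w == h) = (w \in S h).
Proof.
move=> Hh; apply/eqP/idP=> [<-|]; first exact: head_mem.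
elim/rank_ind: w => w IH wS.
case: (eqVneq w h) => [->//|wh].
have [_ [u uS Pw]] := anchored_par (cert_anchored ce (in_setT h)) wS wh.
by rewrite (H_par Pw) (IH u) // wS.
Qed.

Lemma participants_head v a : L (H v) = Some a -> participants pi a = S (H v).
Proof.
move=> La; apply/setP=> w; rewrite inE piE -(head_set w (head_idem v)).
by apply/eqP/eqP=> [Lw|->//]; apply: L_inj Lw La.
Qed.

Lemma coalition_head v : coalition pi v = S (H v).
Proof.
rewrite /coalition piE; case La: (L (H v)) => [a|]; first exact: participants_head.
(* A void label is only valid with size 1, so [S (H v)] reduces to [v], as the definition of
   [coalition] requires. *)
have := anchored_valid (cert_anchored ce (in_setT (H v))).
rewrite La validE => /cards1P[x Sx]; have := head_mem v.
by rewrite Sx => /set1P->.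
Qed.

(** Parent edges lead from each member to [h] without leaving [S h]. *)
Lemma connected_block h : connected_set G (S h).
Proof.
move=> i j iS jS.
pose r := [rel k l | [&& k \in S h, l \in S h & edge G k l]].
have r_sym : connect_sym r.
  by apply: sym_connect_sym => k l /=; rewrite edge_sym andbCA.
suff to_h w : w \in S h -> connect r w h.
  by apply: (connect_trans (to_h i iS)); rewrite r_sym; apply: to_h.
elim/rank_ind: w => w IH wS; case: (eqVneq w h) => [->|wh]; first exact: connect0.
have [_ [u uS Pw]] := anchored_par (cert_anchored ce (in_setT h)) wS wh.
apply: connect_trans (IH u Pw uS); apply: connect1.
by rewrite /= wS uS (cert_edge ce (in_setT w) Pw).
Qed.

Lemma connected_adjacent i T : connected_set G (i |: T) -> i \notin T -> T != set0 ->
  exists2 w, w \in T & edge G i w.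
Proof.
move=> con iT /set0Pn[x xT].
have := con i x (setU11 i T); rewrite inE xT orbT => /(_ isT).
case/connectP=> [[|w s]] /=; first by move=> _ xi; rewrite -xi xT in iT.
case/andP=> /and3P[_ /setU1P[-> | wT] eiw] _ _; first by rewrite edge_irr in eiw.
by exists w.
Qed.

Lemma cert_feasible : feasible G pi.
Proof. by move=> i; rewrite coalition_head; apply: connected_block. Qed.

(** No player ends worse than in the coalition it formed itself. *)
Lemma head_best (i : 'I_n) : q i (encode (pi i)) #|coalition pi i| (encode (L i)) #|S i|.
Proof.
by rewrite coalition_head piE; apply: (cert_mem ce (in_setT _) (head_mem i)).
Qed.

Lemma head_alone (i : 'I_n) b : b <= p -> q i (encode (pi i)) #|coalition pi i| b 1.
Proof.
move=> bp; apply: (prefers_trans (head_best i)).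
exact: (anchored_alone (cert_anchored ce (in_setT i)) bp).
Qed.

Lemma no_IS_deviation i a : ~ IS_deviation G pi i a.
Proof.
case=> -[pia con /andP[better not_worse]] acc; case/negP: not_worse.
suff : q i (encode (pi i)) #|coalition pi i| (encode (Some a)) #|participants pi a|.+1.
  by rewrite prefers_queryE => /and3P[].
have iT : i \notin participants pi a by rewrite inE; apply/eqP.
case: (eqVneq (participants pi a) set0) => [-> | T0].
  by rewrite cards0; apply: head_alone; apply: ltn_ord.
have [w wT eiw] := connected_adjacent con iT T0.
have La : L (H w) = Some a by move: wT; rewrite inE piE => /eqP.
have Tn : #|participants pi a| < n.
  by have := subset_leq_card (subsetT (i |: participants pi a)); rewrite cardsU1 iT cardsT card_ord.
have {}acc : accepts (encode (Some a)) (participants pi a).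
  apply/forallP=> j; apply/implyP=> jT; rewrite prefers_queryE acc //.
  rewrite andbT /alternative /= Tn (ltnW Tn) andbT /=.
  by apply/card_gt0P; exists j.
rewrite (participants_head La) in iT wT acc better *.
case: (cert_adj ce (in_setT i) eiw) => [Pi | [_ Pw]].
  (* If [w] is the parent, [i] lies outside [S (H w)] and heads its own block, so its present
     situation is the one compared in the saturation of [S (H w)]. *)
  have Hi : H i = i by rewrite (H_par Pi) (negbTE iT).
  rewrite coalition_head piE Hi in better *; rewrite -La in acc *.
  apply: (cert_saturated ce (in_setT _) (in_setT i) Pi wT iT acc).
  rewrite prefers_queryE La better andbT -(participants_head La).
  apply/andP; split; first by rewrite /alternative /= Tn.
  by have := anchored_valid (cert_anchored ce (in_setT i)); rewrite /valid decode_encode => ->.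
apply: (prefers_trans (head_best i)).
(* A child [w] of [i] that were not a head would have its parent [i] in its block. So the block is
   [S w], an option that [i] weighed when forming [S i]. *)
have wH : w = H w.
  apply/eqP/negPn/negP=> wH.
  have [_ [u uS]] := anchored_par (cert_anchored ce (in_setT _)) wT wH.
  rewrite Pw => -[/ord_inj iu]; by rewrite iu uS in iT.
rewrite -{}wH in La iT acc *.
have := anchored_child (cert_anchored ce (in_setT i)) (in_setT w) Pw.
by rewrite La; apply.
Qed.

Lemma cert_stable : feasible G pi /\ individually_stable G pi.
Proof.
split; first exact: cert_feasible.
split=> [i|[i [a]]]; last exact: no_IS_deviation.
have := head_alone i (leq0n p).
by rewrite -[0]/(encode (None : activity p)) prefers_queryE => /and3P[].
Qed.

End Stable.

End Certificate.

(** * Programs with counted loops *)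

(* [CFor x b c] runs [c] with the counter in cell 0 of array [x] ranging over the
   players if [b], over the activities otherwise.  All runs are thus polynomially
   bounded and have a functional semantics. *)
Inductive cmd : Type :=
| CSkip
| CPut of nat & expr & expr
| CSeq of cmd & cmd
| CIf of expr & cmd & cmd
| CFor of nat & bool & cmd.

Definition scalar (x : nat) : expr := Get x (Const 0).

Definition bound_expr (b : bool) : expr := if b then Players else Activities.

Fixpoint compile (c : cmd) : prog :=
  match c with
  | CSkip => Skip
  | CPut x e1 e2 => Put x e1 e2
  | CSeq c1 c2 => Seq (compile c1) (compile c2)
  | CIf e c1 c2 => If e (compile c1) (compile c2)
  | CFor x b c1 =>
      Seq (Put x (Const 0) (Const 0))
        (While (Defs.Sub (bound_expr b) (scalar x))
           (Seq (compile c1) (Put x (Const 0) (Add (scalar x) (Const 1)))))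
  end.

Fixpoint writes (c : cmd) : seq nat :=
  match c with
  | CSkip => [::]
  | CPut x _ _ => [:: x]
  | CSeq c1 c2 | CIf _ c1 c2 => writes c1 ++ writes c2
  | CFor x _ c1 => x :: writes c1
  end.

Fixpoint loops_ok (c : cmd) : bool :=
  match c with
  | CSkip | CPut _ _ _ => true
  | CSeq c1 c2 | CIf _ c1 c2 => loops_ok c1 && loops_ok c2
  | CFor x _ c1 => (x \notin writes c1) && loops_ok c1
  end.

Section Run.

Context {n p : nat} (G : gGASP n p).

Fixpoint run (c : cmd) (s : store) : store :=
  match c with
  | CSkip => s
  | CPut x e1 e2 => update s x (eval G s e1) (eval G s e2)
  | CSeq c1 c2 => run c2 (run c1 s)
  | CIf e c1 c2 => if eval G s e != 0 then run c1 s else run c2 s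
  | CFor x b c1 =>
      iteri (if b then n else p) (fun k s' => update (run c1 s') x 0 k.+1)
        (update s x 0 0)
  end.

Lemma updateE s x k v y l :
  update s x k v y l = if (y == x) && (l == k) then v else s y l.
Proof. by []. Qed.

Lemma update_neq s x k v y l : y != x -> update s x k v y l = s y l.
Proof. by rewrite /update => /negbTE->. Qed.

Lemma run_frame c s y l : y \notin writes c -> run c s y l = s y l.
Proof.
elim: c s => [|x e1 e2|c1 IH1 c2 IH2|e c1 IH1 c2 IH2|x b c IH] s //=.
- by rewrite inE; apply: update_neq.
- by rewrite mem_cat negb_or => /andP[y1 y2]; rewrite IH2 ?IH1.
- by rewrite mem_cat negb_or => /andP[y1 y2]; case: ifP => _; rewrite ?IH2 ?IH1.
rewrite inE negb_or => /andP[yx yc].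
elim: (if b then n else p) => [|m IHm] /=; first exact: update_neq.
by rewrite update_neq // IH.
Qed.

(** The body may assume the value of the counter and that all arrays the loop does not write keep
    their contents from before it, so [I] only has to describe what changes. *)
Lemma run_for (I : nat -> store -> Prop) x b c s :
  x \notin writes c -> I 0 (update s x 0 0) ->
  (forall k s', k < (if b then n else p) -> s' x 0 = k ->
     (forall y l, y \notin x :: writes c -> s' y l = s y l) ->
     I k s' -> I k.+1 (update (run c s') x 0 k.+1)) ->
  I (if b then n else p) (run (CFor x b c) s).
Proof.
move=> xc I0 IS /=; set N := if b then n else p in IS *.
set f := fun k s' => _.
suff H m : m <= N -> [/\ I m (iteri m f (update s x 0 0)),
    iteri m f (update s x 0 0) x 0 = m
  & forall y l, y \notin x :: writes c -> iteri m f (update s x 0 0) y l = s y l].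
  by have [] := H N (leqnn N).
elim: m => [|m IHm] mN /=.
  split=> //; first by rewrite updateE !eqxx.
  by move=> y l; rewrite inE negb_or => /andP[yx _]; apply: update_neq.
have [Im xm fr] := IHm (ltnW mN); split; first exact: IS.
  by rewrite /f updateE !eqxx.
move=> y l; rewrite inE negb_or => /andP[yx yc].
by rewrite /f update_neq // run_frame // fr // inE negb_or yx.
Qed.

Lemma run_for_players (I : nat -> store -> Prop) x c s :
  x \notin writes c -> I 0 (update s x 0 0) ->
  (forall k s', k < n -> s' x 0 = k ->
     (forall y l, y \notin x :: writes c -> s' y l = s y l) ->
     I k s' -> I k.+1 (update (run c s') x 0 k.+1)) ->
  I n (run (CFor x true c) s).
Proof. exact: (@run_for I x true). Qed.

Lemma run_for_activities (I : nat -> store -> Prop) x c s :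
  x \notin writes c -> I 0 (update s x 0 0) ->
  (forall k s', k < p -> s' x 0 = k ->
     (forall y l, y \notin x :: writes c -> s' y l = s y l) ->
     I k s' -> I k.+1 (update (run c s') x 0 k.+1)) ->
  I p (run (CFor x false c) s).
Proof. exact: (@run_for I x false). Qed.

End Run.

(** The constants depend on the program alone: each nested loop raises the degree by one. *)
Lemma exec_run c : loops_ok c ->
  exists k d, forall n p (G : gGASP n p) s,
    exists2 t, exec G (compile c) s t (run G c s) & t <= k * (n + p).+1 ^ d.
Proof.
have pw N d1 d2 : d1 <= d2 -> N.+1 ^ d1 <= N.+1 ^ d2 by move=> h; rewrite leq_pexp2l.
elim: c => [|x e1 e2|c1 IH1 c2 IH2|e c1 IH1 c2 IH2|x b c IH] /=.
- by exists 1, 0 => n p G s; exists 1 => //; constructor.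
- move=> _; exists (cost e1 + cost e2).+1, 0 => n p G s.
  by exists (cost e1 + cost e2).+1; [constructor | rewrite expn0 muln1].
- case/andP=> /IH1[k1 [d1 H1]] /IH2[k2 [d2 H2]].
  exists (k1 + k2), (maxn d1 d2) => n p G s.
  have [t1 E1 B1] := H1 n p G s; have [t2 E2 B2] := H2 n p G (run G c1 s).
  exists (t1 + t2); first exact: ExecSeq E1 E2.
  rewrite mulnDl leq_add //; [apply: (leq_trans B1) | apply: (leq_trans B2)];
    by rewrite leq_mul2l pw ?orbT // ?leq_maxl ?leq_maxr.
- case/andP=> /IH1[k1 [d1 H1]] /IH2[k2 [d2 H2]].
  exists (k1 + k2 + (cost e).+1), (maxn d1 d2) => n p G s.
  have [t1 E1 B1] := H1 n p G s; have [t2 E2 B2] := H2 n p G s.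
  have g : 0 < (n + p).+1 ^ maxn d1 d2 by rewrite expn_gt0.
  have h1 := leq_trans B1 (leq_mul (leqnn k1) (pw (n + p) _ _ (leq_maxl d1 d2))).
  have h2 := leq_trans B2 (leq_mul (leqnn k2) (pw (n + p) _ _ (leq_maxr d1 d2))).
  set M := _ ^ _ in g h1 h2 *.
  have h3 : (cost e).+1 <= (cost e).+1 * M by rewrite leq_pmulr.
  rewrite !mulnDl; case: ifP => [ne|/negbFE/eqP e0].
    exists (cost e + t1).+1; first exact: ExecIfTrue.
    lia.
  exists (cost e + t2).+1; first exact: ExecIfFalse.
  lia.
(* A round costs 11 steps besides the body, the failing guard 5 and the initialisation 3; the
   constants 15 and 20 leave room for all of them. *)
case/andP=> xc /IH[k [d H]]; exists (k + 20), d.+1 => n p G s.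
set N := if b then n else p; pose f k s' := update (run G c s') x 0 k.+1.
set g := Defs.Sub _ _; set body := Seq (compile c) _; set B := k * (n + p).+1 ^ d + 15.
have gE s' : eval G s' g = N - s' x 0 by rewrite /g /N; case: (b).
have gc : cost g = 4 by rewrite /g; case: (b).
(* Induction on the number [m] of remaining rounds; since [While] unrolls its first round and
   [iteri] its last, the iterates are shifted by [N - m]. *)
have loop m s' : m <= N -> s' x 0 = N - m ->
    exists2 t, exec G (While g body) s' t (iteri m (fun j => f (N - m + j)) s') & t <= m * B + 5.
  elim: m s' => [|m IHm] s' mN xs.
    exists (cost g).+1; last by rewrite gc.
    by apply: ExecWhileFalse; rewrite gE xs subn0 subnn.
  have [t1 E1 B1] := H n p G s'.
  have x1 : run G c s' x 0 = N - m.+1 by rewrite run_frame.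
  have xf : f (N - m.+1) s' x 0 = N - m by rewrite /f updateE !eqxx /=; lia.
  have [t2 E2 B2] := IHm _ (ltnW mN) xf.
  exists (cost g + (t1 + (cost (Const 0) + cost (Add (scalar x) (Const 1))).+1) + t2).+1.
    have -> : iteri m.+1 (fun j => f (N - m.+1 + j)) s' =
              iteri m (fun j => f (N - m + j)) (f (N - m.+1) s').
      have sh j : N - m.+1 + j.+1 = N - m + j by lia.
      have : forall i, iteri i.+1 (fun j => f (N - m.+1 + j)) s' =
              iteri i (fun j => f (N - m + j)) (f (N - m.+1) s').
        elim=> [|i IHi]; first by rewrite /= addn0.
        by rewrite iteriS IHi /= sh.
      exact.
    apply: ExecWhileTrue E2; first by rewrite gE xs; lia.
    apply: ExecSeq E1 _.
    have -> : f (N - m.+1) s' = update (run G c s') x (eval G (run G c s') (Const 0))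
                (eval G (run G c s') (Add (scalar x) (Const 1))) by rewrite /f /= x1 addn1.
    exact: ExecPut.
  rewrite gc /= mulSn; lia.
have x0 : update s x 0 0 x 0 = N - N by rewrite updateE !eqxx subnn.
have [t E Bt] := loop N _ (leqnn N) x0.
exists (3 + t).
  apply: (ExecSeq (ExecPut _ _ _ _ _)); move: E; rewrite subnn.
  by congr exec; elim: (N) => //= m ->; rewrite add0n.
have : N <= n + p by rewrite /N; case: (b); rewrite ?leq_addr ?leq_addl.
have gt0 : 0 < (n + p).+1 ^ d by rewrite expn_gt0.
rewrite /B in Bt; rewrite expnS; set M := _ ^ d in Bt gt0 *.
move: Bt gt0; move: (n + p) => q Bt gt0 Nq.
apply: leq_trans (leq_add (leqnn 3) Bt) _; nia.
Qed.

Arguments run : simpl never.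

(* Arrays [xOut] to [xHead] are indexed by players, except [xUsed] (activities),
   [xOrd] (elimination rounds) and [xMem]: cell [v * n + w] of [xMem] tells whether
   [w] is in [S v], and [xRow] stores the offsets [v * n].  The remaining ones are
   used as scalars, through their cell 0.  [xPar], [xAct], [xLab], [xPV], [xBA],
   [xBK], [xA], [xC] and [xQ] in [leaf_test] hold [0] for none and indices plus
   one, and [xDone] holds the round of elimination plus one. *)
Local Notation xOut := 0 (only parsing).
Local Notation xDone := 1 (only parsing).
Local Notation xPar := 2 (only parsing).
Local Notation xAct := 3 (only parsing).
Local Notation xSize := 4 (only parsing).
Local Notation xRow := 5 (only parsing).
Local Notation xMem := 6 (only parsing).
Local Notation xOrd := 7 (only parsing).
Local Notation xLab := 8 (only parsing).
Local Notation xUsed := 9 (only parsing).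
Local Notation xHead := 10 (only parsing).
Local Notation xV := 11 (only parsing).
Local Notation xPV := 12 (only parsing).
Local Notation xBA := 13 (only parsing).
Local Notation xBS := 14 (only parsing).
Local Notation xBK := 15 (only parsing).
Local Notation xR := 16 (only parsing).
Local Notation xA := 17 (only parsing).
Local Notation xZ := 18 (only parsing).
Local Notation xOk := 19 (only parsing).
Local Notation xC := 20 (only parsing).
Local Notation xBad := 21 (only parsing).
Local Notation xQ := 22 (only parsing).
Local Notation xt := 23 (only parsing).
Local Notation xu := 24 (only parsing).
Local Notation xw := 25 (only parsing).
Local Notation xj := 26 (only parsing).
Local Notation xk := 27 (only parsing).
Local Notation xr := 28 (only parsing).

(** * The algorithm *)

Definition enot (e : expr) : expr := Defs.Sub (Const 1) e.
(** Conjunction by De Morgan: by truncated subtraction, [enot] yields 1 on 0 and 0 elsewhere. *)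
Definition eand (e1 e2 : expr) : expr := enot (Add (enot e1) (enot e2)).
Definition eeq (e1 e2 : expr) : expr := enot (Add (Defs.Sub e1 e2) (Defs.Sub e2 e1)).
Definition esucc (e : expr) : expr := Add e (Const 1).
Definition epred (e : expr) : expr := Defs.Sub e (Const 1).
Definition set_scalar (x : nat) (e : expr) : cmd := CPut x (Const 0) e.
Definition cwhen (e : expr) (c : cmd) : cmd := CIf e c CSkip.

Local Infix ";;" := CSeq (at level 90, right associativity).

(** The machine has no multiplication; the offsets [v * n] are obtained by repeated addition. *)
Definition row_init : cmd :=
  CFor xu true (CPut xRow (esucc (scalar xu)) (Add (Get xRow (scalar xu)) Players)).

(** Row offset, activity and size of the coalition are passed in [xR], [xA] and [xZ]; the verdict is
    left in [xOk]. *)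
Definition accept : cmd :=
  set_scalar xOk (Const 1) ;;
  CFor xj true (cwhen
    (eand (Get xMem (Add (scalar xR) (scalar xj)))
      (enot (Prefers (scalar xj) (scalar xA) (esucc (scalar xZ)) (scalar xA) (scalar xZ))))
    (set_scalar xOk (Const 0))).

(* [xBad] is set when [xu] has two remaining neighbours; otherwise [xQ] gets its
   parent. *)
Definition leaf_test : cmd :=
  set_scalar xBad (Const 0) ;; set_scalar xQ (Const 0) ;;
  CFor xw true (cwhen
    (eand (enot (Get xDone (scalar xw))) (Adjacent (scalar xu) (scalar xw)))
    (CIf (scalar xQ) (set_scalar xBad (Const 1)) (set_scalar xQ (esucc (scalar xw))))).

(** Loops have no early exit: the last leaf met is the one kept. *)
Definition find_leaf : cmd :=
  CFor xu true (cwhen (enot (Get xDone (scalar xu)))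
    (leaf_test ;; cwhen (enot (scalar xBad))
      (set_scalar xV (scalar xu) ;; set_scalar xPV (scalar xQ)))).

(** [xBA], [xBS] and [xBK] hold the activity, the group size and the child of the best option so
    far. *)
Definition choose_alone : cmd :=
  set_scalar xBA (Const 0) ;; set_scalar xBS (Const 1) ;; set_scalar xBK (Const 0) ;;
  CFor xk false (cwhen
    (Prefers (scalar xV) (esucc (scalar xk)) (Const 1) (scalar xBA) (Const 1))
    (set_scalar xBA (esucc (scalar xk)))).

Definition choose_child : cmd :=
  CFor xk true (cwhen (eeq (Get xPar (scalar xk)) (esucc (scalar xV)))
    (set_scalar xR (Get xRow (scalar xk)) ;;
     set_scalar xA (Get xAct (scalar xk)) ;;
     set_scalar xZ (Get xSize (scalar xk)) ;;
     accept ;;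
     cwhen (eand (scalar xOk)
         (Prefers (scalar xV) (scalar xA) (esucc (scalar xZ)) (scalar xBA) (scalar xBS)))
       (set_scalar xBA (scalar xA) ;; set_scalar xBS (esucc (scalar xZ)) ;;
        set_scalar xBK (esucc (scalar xk))))).

Definition init_row : cmd :=
  set_scalar xR (Get xRow (scalar xV)) ;;
  set_scalar xA (scalar xBA) ;; set_scalar xZ (scalar xBS) ;;
  cwhen (scalar xBK)
    (CFor xj true (CPut xMem (Add (scalar xR) (scalar xj))
       (Get xMem (Add (Get xRow (epred (scalar xBK))) (scalar xj))))) ;;
  CPut xMem (Add (scalar xR) (scalar xV)) (Const 1).

(** Conjuncts are evaluated eagerly: for a missing parent the cell read by the second one is
    meaningless, but the first one rejects. A nonzero parent code also shows that [j] is
    eliminated. *)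
Definition find_join : cmd :=
  set_scalar xC (Const 0) ;;
  CFor xj true (cwhen
    (eand (Get xPar (scalar xj))
    (eand (Get xMem (Add (scalar xR) (epred (Get xPar (scalar xj)))))
    (eand (enot (Get xMem (Add (scalar xR) (scalar xj))))
    (eand (Prefers (scalar xj) (scalar xA) (esucc (scalar xZ))
             (Get xAct (scalar xj)) (Get xSize (scalar xj)))
      (enot (Prefers (scalar xj) (Get xAct (scalar xj)) (Get xSize (scalar xj))
             (scalar xA) (esucc (scalar xZ))))))))
    (set_scalar xC (esucc (scalar xj)))).

Definition grow_step : cmd :=
  accept ;; find_join ;;
  cwhen (eand (scalar xOk) (scalar xC))
    (CPut xMem (Add (scalar xR) (epred (scalar xC))) (Const 1) ;;
     set_scalar xZ (esucc (scalar xZ))).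

Definition grow : cmd := CFor xr true grow_step.

Definition finish : cmd :=
  CPut xAct (scalar xV) (scalar xA) ;; CPut xSize (scalar xV) (scalar xZ) ;;
  CPut xPar (scalar xV) (scalar xPV) ;; CPut xDone (scalar xV) (esucc (scalar xt)) ;;
  CPut xOrd (scalar xt) (scalar xV).

Definition eliminate : cmd :=
  find_leaf ;; choose_alone ;; choose_child ;; init_row ;; grow ;; finish.

Definition eliminate_all : cmd := CFor xt true eliminate.

Definition equiv_test : cmd :=
  set_scalar xOk (Const 1) ;;
  CFor xw true (CFor xj true (cwhen
    (enot (eand
      (Prefers (scalar xw) (Get xAct (scalar xu)) (esucc (scalar xj))
         (esucc (scalar xk)) (esucc (scalar xj)))
      (Prefers (scalar xw) (esucc (scalar xk)) (esucc (scalar xj))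
         (Get xAct (scalar xu)) (esucc (scalar xj)))))
    (set_scalar xOk (Const 0)))).

Definition find_copy : cmd :=
  CFor xk false (equiv_test ;;
    cwhen (eand (scalar xOk) (enot (Get xUsed (scalar xk))))
      (set_scalar xC (esucc (scalar xk)))).

(** Void coalitions keep the label [0]; the others greedily take a fresh copy. *)
Definition label_all : cmd :=
  CFor xu true (cwhen (Get xAct (scalar xu))
    (find_copy ;; CPut xLab (scalar xu) (scalar xC) ;;
     CPut xUsed (epred (scalar xC)) (Const 1))).

(* Rounds are visited backwards, so that a parent is treated before its children. *)
Definition assign : cmd :=
  set_scalar xV (Get xOrd (Defs.Sub (epred Players) (scalar xt))) ;;
  set_scalar xQ (Get xHead (epred (Get xPar (scalar xV)))) ;;
  CIf (eand (Get xPar (scalar xV)) (Get xMem (Add (Get xRow (scalar xQ)) (scalar xV))))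
    (CPut xHead (scalar xV) (scalar xQ)) (CPut xHead (scalar xV) (scalar xV)) ;;
  CPut xOut (scalar xV) (Get xLab (Get xHead (scalar xV))).

Definition assign_all : cmd := CFor xt true assign.

Definition solve : cmd := row_init ;; eliminate_all ;; label_all ;; assign_all.

Lemma solve_ok : loops_ok solve. Proof. by []. Qed.

(** * Correctness of the program: evaluation and elementary loops *)

Section Correctness.

Context {n p : nat} (G : gGASP n p).
Implicit Types (s : store) (k : nat).

Local Notation q := (prefers_query G).
Local Notation run := (run G).

Lemma eval_not s e : (eval G s (enot e) != 0) = ~~ (eval G s e != 0).
Proof. by rewrite /enot /=; case: (eval G s e). Qed.

Lemma eval_and s e1 e2 :
  (eval G s (eand e1 e2) != 0) = (eval G s e1 != 0) && (eval G s e2 != 0).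
Proof. by rewrite /eand /=; case: (eval G s e1); case: (eval G s e2). Qed.

Lemma eval_eq s e1 e2 : (eval G s (eeq e1 e2) != 0) = (eval G s e1 == eval G s e2).
Proof. by rewrite /eeq /=; apply/idP/idP; lia. Qed.

Lemma eval_succ s e : eval G s (esucc e) = (eval G s e).+1.
Proof. exact: addn1. Qed.

Lemma eval_pred s e : eval G s (epred e) = (eval G s e).-1.
Proof. exact: subn1. Qed.

Lemma eval_scalar s x : eval G s (scalar x) = s x 0. Proof. by []. Qed.

Lemma eval_get s x e : eval G s (Get x e) = s x (eval G s e). Proof. by []. Qed.

Lemma eval_add s e1 e2 : eval G s (Add e1 e2) = eval G s e1 + eval G s e2.
Proof. by []. Qed.

Lemma eval_adjacent s e1 e2 :
  (eval G s (Adjacent e1 e2) != 0) = adjacent_query G (eval G s e1) (eval G s e2).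
Proof. by rewrite /= eqb0 negbK. Qed.

Lemma eval_prefers s e1 e2 e3 e4 e5 : (eval G s (Prefers e1 e2 e3 e4 e5) != 0) =
  q (eval G s e1) (eval G s e2) (eval G s e3) (eval G s e4) (eval G s e5).
Proof. by rewrite /= eqb0 negbK. Qed.

Lemma run_seq c1 c2 s : run (c1 ;; c2) s = run c2 (run c1 s). Proof. by []. Qed.

Lemma run_put x e1 e2 s :
  run (CPut x e1 e2) s = update s x (eval G s e1) (eval G s e2).
Proof. by []. Qed.

Lemma run_set x e s : run (set_scalar x e) s = update s x 0 (eval G s e).
Proof. by []. Qed.

Lemma run_if e c1 c2 s :
  run (CIf e c1 c2) s = if eval G s e != 0 then run c1 s else run c2 s.
Proof. by []. Qed.

Lemma run_when e c s : run (cwhen e c) s = if eval G s e != 0 then run c s else s.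
Proof. by []. Qed.

Lemma eval_const s k : eval G s (Const k) = k. Proof. by []. Qed.

Lemma eval_players s : eval G s Players = n. Proof. by []. Qed.

Definition evalE := (eval_not, eval_and, eval_eq, eval_succ, eval_pred, eval_scalar,
  eval_get, eval_add, eval_adjacent, eval_prefers, eval_const, eval_players).

Definition runE := (run_seq, run_put, run_set, run_if, run_when).

Lemma eval_sub s e1 e2 : eval G s (Defs.Sub e1 e2) = eval G s e1 - eval G s e2.
Proof. by []. Qed.

Lemma run_frame_in c L s y l :
  all [pred x | x \notin writes c] L -> y \in L -> run c s y l = s y l.
Proof. by move=> /allP LP /LP; apply: run_frame. Qed.

Lemma run_row_init s : s xRow 0 = 0 ->
  forall i, i <= n -> run row_init s xRow i = i * n.
Proof.
move=> s0; pose I k (s' : store) := forall i, i <= k -> s' xRow i = i * n.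
apply: (run_for_players (I := I)) => //; first by move=> i; rewrite leqn0 => /eqP->.
move=> k s' _ sk _ IH i ik; rewrite runE !evalE !updateE /= sk.
by case: eqVneq => [->|ne]; [rewrite IH // mulSn addnC | apply: IH; lia].
Qed.

Definition row (s : store) (v : nat) : {set 'I_n} := [set w : 'I_n | s xMem (v * n + w) != 0].

Lemma row_eq (s s' : store) v :
  (forall w : 'I_n, s xMem (v * n + w) = s' xMem (v * n + w)) -> row s v = row s' v.
Proof. by move=> E; apply/setP=> w; rewrite !inE E. Qed.

(** Quotient and remainder by [n] recover row and column. *)
Lemma cell_inj (v v' w w' : nat) : w < n -> w' < n ->
  (v * n + w == v' * n + w') = (v == v') && (w == w').
Proof.
move=> wn wn'; apply/eqP/andP=> [E | [/eqP-> /eqP-> //]].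
have n0 : 0 < n by case: (n) wn.
have := congr1 (divn^~ n) E; have := congr1 (modn^~ n) E.
by rewrite /= !modnMDl !divnMDl // !modn_small // !divn_small // !addn0 => -> ->.
Qed.

(** Rule for loops that clear the flag [r] at each failing index; nested use handles two
    quantifiers. *)
Lemma run_forall x r c s (F : 'I_n -> bool) : x \notin writes c -> r != x ->
  (forall (k : 'I_n) s', s' x 0 = k ->
     (forall y l, y \notin x :: writes c -> s' y l = s y l) ->
     (run c s' r 0 != 0) = (s' r 0 != 0) && F k) ->
  (run (CFor x true c) s r 0 != 0) = (s r 0 != 0) && [forall k, F k].
Proof.
move=> xc rx step.
pose I k (s' : store) := (s' r 0 != 0) = (s r 0 != 0) && [forall j : 'I_n, (j < k) ==> F j].
have -> : [forall k, F k] = [forall j : 'I_n, (j < n) ==> F j].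
  by apply: eq_forallb => j; rewrite ltn_ord.
apply: (run_for_players (I := I)) => //.
  by rewrite /I update_neq // (introT forallP) ?andbT.
move=> k s' kn sk fr IH; rewrite /I update_neq // (step (Ordinal kn)) // IH -andbA.
congr (_ && _); apply/andP/forallP=> [[/forallP H Fk] j|H].
  apply/implyP; rewrite ltnS leq_eqVlt => /orP[/eqP jk | jk]; last by have := H j; rewrite jk.
  by rewrite (_ : j = Ordinal kn) //; apply: val_inj.
split; last by have := H (Ordinal kn); rewrite /= ltnSn.
by apply/forallP=> j; apply/implyP=> jk; have := H j; rewrite ltnS (ltnW jk).
Qed.

Lemma run_accept s v : s xR 0 = v * n -> s xZ 0 = #|row s v| ->
  (run accept s xOk 0 != 0) = accepts G (s xA 0) (row s v).
Proof.
move=> sR sZ; rewrite /accept run_seq run_set evalE.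
rewrite (run_forall (F := fun j => (j \in row s v) ==>
  q j (s xA 0) #|row s v|.+1 (s xA 0) #|row s v|)) // => j s' sj fr.
rewrite run_when !evalE sj !(fr xMem, fr xR, fr xA, fr xZ) // !updateE /= sR sZ inE.
case: (s xMem _ != 0); case: (q _ _ _ _ _);
  by rewrite /= ?andbT ?andbF.
Qed.

(** * Searching for a leaf *)

Definition done (s : store) : {set 'I_n} := [set v : 'I_n | s xDone v != 0].

(** These are the demands of [cert_extend] on the parent of a new vertex; [0] stands for a root. *)
Definition parent_code (D : {set 'I_n}) (u : 'I_n) (m : nat) : Prop :=
  [/\ m <= n,
      forall w : 'I_n, m = w.+1 -> w \notin D /\ edge G u w &
      forall w : 'I_n, w \notin D -> edge G u w -> m = w.+1].

Lemma run_leaf_test s (u : 'I_n) : s xu 0 = u -> u \in ~: done s ->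
  let s' := run leaf_test s in
  (s' xBad 0 = 0 -> parent_code (done s) u (s' xQ 0)) /\
  (leaf G (done s) u -> s' xBad 0 = 0).
Proof.
move=> su uD /=; rewrite /leaf_test !run_seq !run_set; set s1 := update _ _ _ _.
(* While [xBad] is 0, [xQ] names the only remaining neighbour seen so far; the last clause keeps
   genuine leaves from being rejected. *)
pose I k (s' : store) := [/\ s' xQ 0 <= k,
    forall w : 'I_n, s' xQ 0 = w.+1 -> w \notin done s /\ edge G u w,
    s' xBad 0 = 0 -> forall w : 'I_n, w < k -> w \notin done s -> edge G u w ->
      s' xQ 0 = w.+1 &
    leaf G (done s) u -> s' xBad 0 = 0].
suff [q1 q2 q3 q4] : I n (run (CFor xw true (cwhen
      (eand (enot (Get xDone (scalar xw))) (Adjacent (scalar xu) (scalar xw)))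
    (CIf (scalar xQ) (set_scalar xBad (Const 1)) (set_scalar xQ (esucc (scalar xw)))))) s1).
  by split=> // bad; split=> // w; apply: q3.
apply: (run_for_players (I := I)) => // k s' kn sk fr [q1 q2 q3 q4].
pose k' := Ordinal kn.
have ltk (w : 'I_n) : w < k.+1 -> w < k \/ w = k'.
  by rewrite ltnS leq_eqVlt => /orP[/eqP wk|]; [right; apply: val_inj | left].
rewrite /I run_when !evalE sk !fr // /s1 !updateE /= su.
rewrite [k in adjacent_query _ _ k](_ : k = k') // adjacent_queryE.
have -> : ~~ (s xDone k != 0) = (k' \notin done s) by rewrite inE.
case: ifP => [/andP[kD uk] | no].
  rewrite run_if evalE; case: ifP => [Q0|/negbFE/eqP Q0].
    rewrite run_set !updateE /=; split=> //; first exact: leqW.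
    (* [xQ] already names a remaining neighbour of index below [k]; for a leaf it would coincide
       with [k]. *)
    have [w Qw] : exists w : 'I_n, s' xQ 0 = w.+1.
      case: (s' xQ 0) Q0 q1 => // m _ mk.
      by exists (Ordinal (leq_trans mk (ltnW kn))).
    case=> _ one; have [wD uw] := q2 _ Qw.
    by move: q1; rewrite Qw (one _ _ wD kD uw uk) ltnn.
  rewrite run_set !evalE !updateE /= sk; split=> //.
  - by move=> w [wk]; rewrite (_ : w = k') //; apply: val_inj.
  - move=> bad w /ltk[wk wD uw|->//].
    by have := q3 bad w wk wD uw; rewrite Q0.
split=> //; first exact: leqW.
by move=> bad w /ltk[|-> kD uk]; [exact: q3 | rewrite kD uk in no].
Qed.

Lemma run_find_leaf s : (exists u, leaf G (done s) u) ->
  exists v : 'I_n, let s' := run find_leaf s in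
    [/\ s' xV 0 = v, v \notin done s & parent_code (done s) v (s' xPV 0)].
Proof.
case=> u lu.
(* [xV] is meaningful only once a leaf has been met, hence the implication. *)
pose I k (s' : store) := (exists2 u : 'I_n, u < k & leaf G (done s) u) ->
  exists v : 'I_n, [/\ s' xV 0 = v, v \notin done s & parent_code (done s) v (s' xPV 0)].
suff : I n (run find_leaf s) by apply; exists u.
apply: (run_for_players (I := I)) => //; first by case.
move=> k s' kn sk fr IH; pose k' := Ordinal kn.
have dE : done s' = done s by apply/setP=> w; rewrite !inE fr.
rewrite /I run_when !evalE !updateE /= sk.
have -> : ~~ (s' xDone k != 0) = (k' \in ~: done s') by rewrite !inE.
case: ifP => [kD|kD]; last first.
  case=> w; rewrite ltnS leq_eqVlt => /orP[/eqP wk [wD _]|wk lw].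
    by rewrite inE dE (_ : k' = w) ?wD // in kD; apply: val_inj.
  by apply: IH; exists w.
have [bad0 lbad] := run_leaf_test (u := k') sk kD.
rewrite run_seq run_when !evalE; set s2 := run leaf_test s' in bad0 lbad *.
have fr2 y l : y \notin writes leaf_test -> s2 y l = s' y l by exact: run_frame.
rewrite dE in bad0 lbad kD.
case: ifP => [/negPn/eqP bad _|bad].
  exists k'; rewrite run_seq !run_set !evalE !updateE /= fr2 // sk.
  by split=> //; [rewrite inE in kD | apply: bad0].
case=> w; rewrite ltnS leq_eqVlt => /orP[/eqP wk lw|wk lw].
  by move/negP: bad; case; rewrite lbad // (_ : k' = w) //; apply: val_inj.
by rewrite !fr2 //; apply: IH; exists w.
Qed.

(** * The first choice of a vertex and the invariant of the elimination *)

Lemma run_choose_alone s (v : 'I_n) : s xV 0 = v ->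
  let s' := run choose_alone s in
  [/\ s' xBS 0 = 1, s' xBK 0 = 0 & forall b, b <= p -> q v (s' xBA 0) 1 b 1].
Proof.
move=> sv /=; rewrite /choose_alone !run_seq !run_set !evalE; set s1 := update _ _ _ _.
set c := CFor _ _ _.
suff [sBS sBK sBA] : [/\ run c s1 xBS 0 = s1 xBS 0, run c s1 xBK 0 = s1 xBK 0 &
    forall b, b <= p -> q v (run c s1 xBA 0) 1 b 1].
  by rewrite sBS sBK.
split; try exact: run_frame.
have val1 b : b <= p -> valid n p b 1.
  by rewrite validE; case: b => // b ->; case: (n) v sv => // -[].
(* Activity [k] has code [k.+1], so after [k] rounds the codes [0] to [k] have been compared. *)
pose I k (s' : store) := s' xBA 0 <= p /\ forall b, b <= k -> q v (s' xBA 0) 1 b 1.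
suff [] : I p (run c s1) by [].
apply: (run_for_activities (I := I)) => //.
  by split=> // b; rewrite leqn0 => /eqP->; apply/prefers_refl/val1.
move=> k s' kp sk fr [BAp best]; rewrite /I run_when !evalE !updateE /=.
rewrite sk fr // /s1 !updateE /= sv.
case: ifP => [better|worse].
  rewrite run_set !evalE !updateE /= sk; split=> // b.
  rewrite leq_eqVlt => /orP[/eqP->|bk]; first by apply/prefers_refl/val1.
  exact: prefers_trans better (best _ bk).
split=> // b; rewrite leq_eqVlt => /orP[/eqP->|]; last exact: best.
by have := prefers_total G v (val1 _ kp) (val1 _ BAp); rewrite worse.
Qed.

(** [inv_fresh] provides the empty row in which a new coalition is built; [inv_ord] and [inv_ordV]
    make [xOrd] and [xDone] inverse to each other, up to a shift by one, for the backward pass. *)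
Record elim_inv (t : nat) s : Prop := ElimInv {
  inv_row : forall v : 'I_n, s xRow v = v * n;
  inv_cert : cert G (done s) (fun v => s xDone v) (fun v => s xPar v)
               (fun v => s xAct v) (fun v => row s v);
  inv_size : forall v : 'I_n, v \in done s -> s xSize v = #|row s v|;
  inv_fresh : forall v : 'I_n, v \notin done s -> s xPar v = 0 /\ row s v = set0;
  inv_card : #|done s| = t;
  inv_time : forall v : 'I_n, s xDone v <= t;
  inv_ord : forall v : 'I_n, v \in done s -> s xOrd (s xDone v).-1 = v;
  inv_ordV : forall i, i < t -> exists2 v : 'I_n, s xOrd i = v & s xDone v = i.+1
}.

Lemma inv_done t s (v : 'I_n) m : elim_inv t s -> s xPar v = m.+1 -> v \in done s.
Proof. by move=> inv Pv; apply: contraPT Pv => /(inv_fresh inv)[->]. Qed.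

Lemma inv_bound t s (v : 'I_n) : elim_inv t s -> s xPar v <= n.
Proof.
move=> inv; case: (boolP (v \in done s)) => vD; first exact: cert_bound (inv_cert inv) _ vD.
by have [-> _] := inv_fresh inv vD.
Qed.

(** The third clause remembers the origin of the best option, from which [init_row] rebuilds the
    coalition. *)
Lemma run_choose_child t s (v : 'I_n) : elim_inv t s -> s xV 0 = v ->
  s xBS 0 = 1 -> s xBK 0 = 0 -> (forall b, b <= p -> q v (s xBA 0) 1 b 1) ->
  let s' := run choose_child s in
  [/\ forall b, b <= p -> q v (s' xBA 0) (s' xBS 0) b 1,
      forall k : 'I_n, k \in done s -> s xPar k = v.+1 ->
        accepts G (s xAct k) (row s k) ->
        q v (s' xBA 0) (s' xBS 0) (s xAct k) #|row s k|.+1 &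
      s' xBK 0 = 0 /\ s' xBS 0 = 1 \/
      exists k : 'I_n, [/\ s' xBK 0 = k.+1, s xPar k = v.+1,
        accepts G (s xAct k) (row s k), s' xBA 0 = s xAct k & s' xBS 0 = #|row s k|.+1]].
Proof.
move=> inv sv sBS sBK alone s'.
pose I k (s' : store) := [/\ forall b, b <= p -> q v (s' xBA 0) (s' xBS 0) b 1,
      forall j : 'I_n, j < k -> s xPar j = v.+1 ->
        accepts G (s xAct j) (row s j) ->
        q v (s' xBA 0) (s' xBS 0) (s xAct j) #|row s j|.+1 &
      s' xBK 0 = 0 /\ s' xBS 0 = 1 \/
      exists k : 'I_n, [/\ s' xBK 0 = k.+1, s xPar k = v.+1,
        accepts G (s xAct k) (row s k), s' xBA 0 = s xAct k & s' xBS 0 = #|row s k|.+1]].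
suff [H1 H2 H3] : I n s' by split=> // k _; apply: H2.
apply: (run_for_players (I := I)) => //.
  by split=> //; rewrite ?updateE /= ?sBS //; left.
move=> k {}s' kn sk fr [al ch wit]; pose k' := Ordinal kn.
have ltk (w : 'I_n) : w < k.+1 -> w < k \/ w = k'.
  by rewrite ltnS leq_eqVlt => /orP[/eqP wk|]; [right; apply: val_inj | left].
rewrite /I !updateE /= run_when !evalE sk !fr // sv.
case: eqP => [Pk|noPk]; last first.
  by split=> // j /ltk[|-> /noPk//]; apply: ch.
have kD : k' \in done s by exact: (inv_done (v := k') inv Pk).
rewrite 4!run_seq 3!run_set !evalE; set s1 := update _ xZ _ _; set s2 := run accept s1.
have fr1 y l : y \notin [:: xR; xA; xZ] -> s1 y l = s' y l.
  by rewrite !inE !negb_or => /and3P[? ? ?]; rewrite /s1 !update_neq.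
have fr2 y l : y \notin [:: xR; xA; xZ] ++ writes accept -> s2 y l = s' y l.
  by rewrite mem_cat negb_or => /andP[? ?]; rewrite /s2 run_frame // fr1.
have rowE u : row s1 u = row s u by apply: row_eq => w; rewrite fr1 ?fr.
have s1R : s1 xR 0 = k' * n by rewrite /s1 !updateE /= sk fr // (inv_row inv k').
have s1A : s1 xA 0 = s xAct k' by rewrite /s1 !updateE /= sk fr.
have s1Z : s1 xZ 0 = #|row s k'|.
  by rewrite /s1 !updateE /= sk fr // (inv_size inv kD).
have ok : (s2 xOk 0 != 0) = accepts G (s xAct k') (row s k').
  by rewrite -s1A -rowE; apply: run_accept => //; rewrite rowE.
have s2A : s2 xA 0 = s xAct k' by rewrite /s2 run_frame.
have s2Z : s2 xZ 0 = #|row s k'| by rewrite /s2 run_frame.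
have s2v : s2 xV 0 = v by rewrite fr2 // fr.
rewrite run_when !evalE ok s2A s2Z s2v !(fr2 xBA, fr2 xBS) //.
case: ifP => [/andP[acc better]|worse].
  rewrite !run_seq !run_set !evalE !updateE /= s2A s2Z fr2 // sk; split.
  - by move=> b bp; apply: prefers_trans better (al _ bp).
  - move=> j /ltk[jk|->] Pj accj; last first.
      by apply: prefers_refl; have /andP[] := prefers_valid better.
    by apply: prefers_trans better (ch _ jk Pj accj).
  - by right; exists k'.
rewrite !(fr2 xBA, fr2 xBS, fr2 xBK) //; split=> // j /ltk[|-> _ accj]; first exact: ch.
(* Totality needs valid alternatives; that the child itself accepts a newcomer shows the enlarged
   size to be legal. *)
have := accepts_prefers accj (anchored_in (cert_anchored (inv_cert inv) kD)).
case/prefers_valid/andP=> valk _; have /prefers_valid/andP[val0 _] := al 0 isT.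
by have := prefers_total G v valk val0; rewrite accj /= in worse; rewrite worse.
Qed.

Lemma row_add s (v j : 'I_n) : row (update s xMem (v * n + j) 1) v = j |: row s v.
Proof.
apply/setP=> w; rewrite !inE updateE /= cell_inj // eqxx /=.
by rewrite (inj_eq (@ord_inj n)); case: (w == j).
Qed.

Lemma row_other s (v u j : 'I_n) m : u != v ->
  row (update s xMem (v * n + j) m) u = row s u.
Proof.
move=> uv; apply: row_eq => w.
by rewrite updateE /= cell_inj // (inj_eq val_inj) (negbTE uv).
Qed.

(** As [v] differs from [k], the source row is not overwritten during the copy. *)
Lemma run_copy_row s (v k : 'I_n) : s xR 0 = v * n -> s xBK 0 = k.+1 ->
  s xRow k = k * n -> v != k ->
  let s' := run (CFor xj true (CPut xMem (Add (scalar xR) (scalar xj))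
       (Get xMem (Add (Get xRow (epred (scalar xBK))) (scalar xj))))) s in
  row s' v = row s k /\ forall u : 'I_n, u != v -> row s' u = row s u.
Proof.
move=> sR sBK sRow vk s'.
pose I m (s' : store) := (forall w : 'I_n, w < m -> s' xMem (v * n + w) = s xMem (k * n + w))
  /\ forall u : 'I_n, u != v -> forall w : 'I_n, s' xMem (u * n + w) = s xMem (u * n + w).
suff [H1 H2] : I n s'.
  by split=> [|u uv]; [apply/setP=> w; rewrite !inE H1 | apply: row_eq; apply: H2].
apply: (run_for_players (I := I)) => // m {}s' mn sm fr [H1 H2].
rewrite /I run_put !evalE sm !(fr xR, fr xBK, fr xRow) // sR sBK /= sRow.
split=> [w wm|u uv w]; rewrite !updateE /=; last first.
  by rewrite cell_inj // (inj_eq val_inj) (negbTE uv) H2.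
rewrite cell_inj // eqxx /=; case: (eqVneq (w : nat) m) => [wm'|ne].
  by have := H2 k; rewrite eq_sym vk => /(_ isT (Ordinal mn)) /= ->; rewrite -wm'.
by apply: H1; lia.
Qed.

(** Without a child to join, the row of [v] was empty and [anchored_single] applies; otherwise
    [anchored_join] applies to the copied row. *)
Lemma run_init_row t s0 s (v : 'I_n) : elim_inv t s0 -> v \notin done s0 ->
  (forall y l, y \in [:: xDone; xPar; xAct; xSize; xRow; xMem] -> s y l = s0 y l) ->
  s xV 0 = v ->
  (forall b, b <= p -> q v (s xBA 0) (s xBS 0) b 1) ->
  (forall k : 'I_n, k \in done s0 -> s0 xPar k = v.+1 ->
     accepts G (s0 xAct k) (row s0 k) ->
     q v (s xBA 0) (s xBS 0) (s0 xAct k) #|row s0 k|.+1) ->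
  s xBK 0 = 0 /\ s xBS 0 = 1 \/
    (exists k : 'I_n, [/\ s xBK 0 = k.+1, s0 xPar k = v.+1,
       accepts G (s0 xAct k) (row s0 k), s xBA 0 = s0 xAct k & s xBS 0 = #|row s0 k|.+1]) ->
  let s' := run init_row s in
  [/\ s' xR 0 = v * n, s' xZ 0 = #|row s' v|,
      forall u : 'I_n, u != v -> row s' u = row s0 u &
      anchored G (done s0) (fun v => s0 xPar v) (fun v => s0 xAct v)
        (fun v => row s0 v) v (row s' v) (s' xA 0)].
Proof.
move=> inv vD fr sv al ch wit /=.
rewrite /init_row !run_seq !run_set !evalE !updateE /= sv fr // (inv_row inv).
set s1 := update _ xZ _ _; rewrite run_when !evalE.
have rowE (u : 'I_n) : row s1 u = row s0 u by apply: row_eq => w; rewrite /s1 !updateE /= fr.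
have s1BK : s1 xBK 0 = s xBK 0 by rewrite /s1 !updateE.
have s1R : s1 xR 0 = v * n by rewrite /s1 !updateE.
have s1v : s1 xV 0 = v by rewrite /s1 !updateE.
have s1A : s1 xA 0 = s xBA 0 by rewrite /s1 !updateE.
have s1Z : s1 xZ 0 = s xBS 0 by rewrite /s1 !updateE.
rewrite run_put !evalE s1BK; case: wit => [[BK0 BS1]|[k [BK Pk acc BA BS]]].
  rewrite BK0 /= s1R s1v.
  rewrite !row_add rowE (proj2 (inv_fresh inv vD)) setU0 !updateE /= s1R s1Z s1A cards1.
  split=> // [u uv|]; first by rewrite row_other.
  by rewrite BS1 in al ch; apply: anchored_single.
have kD := inv_done inv Pk.
have vk : v != k by apply: contraNneq vD => ->.
rewrite BK /=.
have s1Row : s1 xRow k = k * n by rewrite /s1 !updateE /= fr // (inv_row inv).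
rewrite BK in s1BK; have [] := run_copy_row s1R s1BK s1Row vk.
set s2 := run _ s1 => row_v row_u.
have fr2 y l : y \notin [:: xj; xMem] -> s2 y l = s1 y l by move=> yn; rewrite /s2 run_frame.
rewrite !fr2 // s1R s1v row_add row_v rowE !updateE /= !fr2 // s1R s1Z s1A.
have Svk : v \notin row s0 k by apply: contra vD; apply/subsetP/(cert_sub (inv_cert inv) kD).
split=> // [|u uv|].
- by rewrite cardsU1 Svk BS.
- by rewrite row_other // row_u.
rewrite BA; apply: (anchored_join (inv_cert inv)) => //.
  by move=> b bp; rewrite -BS -BA; apply: al.
by move=> j jD Pj accj; rewrite -BS -BA; apply: ch.
Qed.

Definition joins s (v j : 'I_n) : bool :=
  [&& [exists w : 'I_n, (s xPar j == w.+1) && (w \in row s v)], j \notin row s v,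
      q j (s xA 0) #|row s v|.+1 (s xAct j) (s xSize j) &
      ~~ q j (s xAct j) (s xSize j) (s xA 0) #|row s v|.+1].

Lemma run_find_join s (v : 'I_n) : s xR 0 = v * n -> s xZ 0 = #|row s v| ->
  (forall j : 'I_n, s xPar j <= n) ->
  let s' := run find_join s in
  (s' xC 0 = 0 /\ forall j, ~~ joins s v j) \/
  (exists2 j : 'I_n, s' xC 0 = j.+1 & joins s v j).
Proof.
move=> sR sZ Pn; rewrite /find_join run_seq run_set evalE.
set s1 := update _ _ _ _; set c := CFor _ _ _; cbv zeta.
pose I k (s' : store) := (s' xC 0 = 0 /\ forall j : 'I_n, j < k -> ~~ joins s v j) \/
  (exists2 j : 'I_n, s' xC 0 = j.+1 & joins s v j).
suff [[-> no]|yes] : I n (run c s1) by [left; split=> // j; apply: no | right].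
apply: (run_for_players (I := I)) => //; first by left.
move=> k s' kn sk fr IH; rewrite /I run_when !evalE !updateE /= sk !fr //.
rewrite /s1 !updateE /= sR sZ; pose k' := Ordinal kn.
have -> : [&& s xPar k != 0, s xMem (v * n + (s xPar k).-1) != 0,
    ~~ (s xMem (v * n + k) != 0), q k (s xA 0) #|row s v|.+1 (s xAct k) (s xSize k)
    & ~~ q k (s xAct k) (s xSize k) (s xA 0) #|row s v|.+1] = joins s v k'.
  rewrite /joins !inE /= andbA; congr (_ && _).
  apply/andP/existsP=> [[] | [w /andP[/eqP-> ]]]; last by rewrite inE.
  case Pk: (s xPar k) => [|m] // _ /= mem.
  have mn : m < n by rewrite -Pk; apply: Pn k'.
  by exists (Ordinal mn); rewrite inE eqxx.
case: ifP => [jk|nok]; first by right; exists k'; rewrite // run_set !evalE updateE /= sk.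
case: IH => [[C0 no]|yes]; last by right.
left; split=> // j; rewrite ltnS leq_eqVlt => /orP[/eqP jk|]; last exact: no.
by rewrite (_ : j = k') ?nok //; apply: val_inj.
Qed.

(** * Growing a coalition *)

Section Grow.

Variables (t : nat) (s0 : store) (v : 'I_n).
Hypotheses (inv0 : elim_inv t s0) (v_new : v \notin done s0).

(** Among the rows, only that of [v], not yet covered by the certificate for [done s0], may depart
    from [s0]. *)
Definition grow_inv s : Prop :=
  [/\ s xR 0 = v * n, s xZ 0 = #|row s v|,
      forall u : 'I_n, u != v -> row s u = row s0 u,
      forall y l, y \in [:: xDone; xPar; xAct; xSize] -> s y l = s0 y l &
      anchored G (done s0) (fun v => s0 xPar v) (fun v => s0 xAct v)
        (fun v => row s0 v) v (row s v) (s xA 0)].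

Definition stuck s : Prop :=
  saturated G (done s0) (fun v => s0 xPar v) (fun v => s0 xAct v)
    (fun v => row s0 v) (row s v) (s xA 0).

Lemma grow_inv_ext s s' : grow_inv s ->
  (forall y l, y \in [:: xDone; xPar; xAct; xSize; xMem; xR; xA; xZ] -> s' y l = s y l) ->
  grow_inv s'.
Proof.
case=> sR sZ oth fr an E; have rowE u : row s' u = row s u by apply: row_eq => w; apply: E.
split; rewrite ?rowE ?E //; first by move=> u uv; rewrite rowE oth.
by move=> y l yL; rewrite -fr // E //; move: yL; rewrite !inE => /or4P[]/eqP->.
Qed.

Lemma joins_step s j : grow_inv s -> joins s v j ->
  exists w : 'I_n, [/\ j \in done s0, s0 xPar j = w.+1 & w \in row s v] /\
    [/\ j \notin row s v, q j (s xA 0) #|row s v|.+1 (s0 xAct j) #|row s0 j|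
    & ~~ q j (s0 xAct j) #|row s0 j| (s xA 0) #|row s v|.+1].
Proof.
case=> _ _ _ fr _; rewrite /joins !(fr xPar, fr xAct, fr xSize) //.
case/and4P=> /existsP[w /andP[/eqP Pj wS]] jS.
have jD := inv_done inv0 Pj; rewrite (inv_size inv0 jD).
by exists w.
Qed.

Lemma not_joins_stuck s : grow_inv s -> (forall j, ~~ joins s v j) -> stuck s.
Proof.
case=> _ _ _ fr _ no j w jD Pj wS jS _ better; apply: contraNT (no j) => worse.
apply/and4P; rewrite !(fr xPar, fr xAct, fr xSize) // (inv_size inv0 jD); split=> //.
by apply/existsP; exists w; rewrite Pj eqxx.
Qed.

(** The clause [~ stuck s] rules out growth after saturation, so a saturated coalition stays as it
    is. *)
Lemma run_grow_step s : grow_inv s ->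
  let s' := run grow_step s in
  grow_inv s' /\ (stuck s' /\ #|row s' v| = #|row s v| \/
                  ~ stuck s /\ #|row s' v| = #|row s v|.+1).
Proof.
move=> gi; have [sR sZ oth fr an] := gi; rewrite /grow_step 2!run_seq.
set s1 := run accept s; set s2 := run find_join s1; cbv zeta.
have fr1 y l : y \notin writes accept -> s1 y l = s y l by exact: run_frame.
have row1 u : row s1 u = row s u by apply: row_eq => w; rewrite fr1.
have s1R : s1 xR 0 = v * n by rewrite fr1.
have s1Z : s1 xZ 0 = #|row s1 v| by rewrite fr1 // row1.
have s1P (j : 'I_n) : s1 xPar j <= n by rewrite fr1 // fr // (inv_bound _ inv0).
have := run_find_join s1R s1Z s1P; rewrite -/s2 => /= find.
have fr2 y l : y \notin writes accept ++ writes find_join -> s2 y l = s y l.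
  by rewrite mem_cat negb_or => /andP[? ?]; rewrite /s2 run_frame // fr1.
have row2 u : row s2 u = row s u by apply: row_eq => w; rewrite fr2.
have ok : (s2 xOk 0 != 0) = accepts G (s xA 0) (row s v).
  by rewrite -run_accept // /s2 run_frame.
have gi1 : grow_inv s1 by apply: (grow_inv_ext gi) => y l; apply: run_frame_in.
have gi2 : grow_inv s2 by apply: (grow_inv_ext gi1) => y l; apply: run_frame_in.
rewrite run_when !evalE ok; case: ifP => [/andP[acc C0]|no]; last first.
  split=> //; left; rewrite row2; split=> //.
  (* Nothing was added: either no vertex wants to join, or one does and then acceptance has failed,
     which makes saturation vacuous. *)
  case: find => [[_ nojoin]|[j Cj _]].
    by move: (not_joins_stuck gi1 nojoin); rewrite /stuck row1 row2 fr1 // fr2.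
  by move=> j' w _ _ _ _; rewrite row2 fr2 // => acc; rewrite acc Cj in no.
case: find => [[C0' _]|[j Cj jj]]; first by rewrite C0' in C0.
have [w [[jD Pj wS] [jS better nworse]]] := joins_step gi1 jj.
rewrite !row1 !fr1 // in wS jS better nworse.
rewrite run_seq run_put run_set !evalE Cj /= fr2 // sR.
set s3 := update _ xZ _ _.
have row3 : row s3 v = j |: row s v by rewrite -row2 -row_add; apply: row_eq.
have cS : #|row s3 v| = #|row s v|.+1 by rewrite row3 cardsU1 jS.
split; last first.
  right; split=> // st; case/negP: nworse.
  exact: (st j w).
split.
- by rewrite /s3 !updateE /= fr2.
- by rewrite /s3 !updateE /= -/s3 cS fr2 // sZ.
- move=> u uv; rewrite -(oth u uv) -row2 -(row_other s2 j 1 uv).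
  exact: row_eq.
- move=> y l yL; rewrite -fr // -fr2; last by move: yL; rewrite !inE => /or4P[]/eqP->.
  by rewrite /s3 !updateE; move: yL; rewrite !inE => /or4P[]/eqP->.
- rewrite row3 /s3 !updateE /= fr2 //; exact: (anchored_grow an acc jD Pj wS jS better).
Qed.

(** The coalition starts with [v] and gains a member in each round until it is stuck; its size
    cannot exceed [n], so [n] rounds suffice. *)
Lemma run_grow s : grow_inv s ->
  let s' := run grow s in grow_inv s' /\ stuck s'.
Proof.
move=> gi; pose I k (s' : store) := grow_inv s' /\ (stuck s' \/ k < #|row s' v|).
have ctr s1 k : grow_inv s1 -> grow_inv (update s1 xr 0 k).
  move/grow_inv_ext; apply=> y l yL; rewrite update_neq //.
  by apply: contraTneq yL => ->.
suff [gi' [//|big]] : I n (run grow s).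
  by have := max_card (mem (row (run grow s) v)); rewrite card_ord leqNgt big.
apply: (run_for_players (I := I)) => //.
  split; first exact: ctr; right; apply/card_gt0P; exists v.
  by case: gi => _ _ _ _ /anchored_in.
move=> k s' kn _ _ [gi' st].
have [gi2 step] := run_grow_step gi'; split; first exact: ctr.
case: step => [[st2 _]|[nst card2]]; first by left.
by right; case: st => // kS; rewrite (_ : row _ v = row (run grow_step s') v) ?card2.
Qed.

End Grow.

(** * One round of elimination *)

Lemma elim_inv_ext t s s' : elim_inv t s ->
  (forall y l, y \in [:: xDone; xPar; xAct; xSize; xRow; xMem; xOrd] -> s' y l = s y l) ->
  elim_inv t s'.
Proof.
case=> r ce sz fresh card time ord ordV E.
have rowE u : row s' u = row s u by apply: row_eq => w; apply: E.
have dE : done s' = done s by apply/setP=> w; rewrite !inE E.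
split; rewrite ?dE //.
- by move=> v; rewrite E.
- by apply: (cert_ext ce) => v; rewrite ?E.
- by move=> v vD; rewrite E // rowE sz.
- by move=> v vD; rewrite E // rowE; apply: fresh.
- by move=> v; rewrite E.
- by move=> v vD; rewrite !E // ord.
- by move=> i it; have [v v1 v2] := ordV i it; exists v; rewrite E.
Qed.

Lemma run_finish t s0 s (v : 'I_n) : elim_inv t s0 -> v \notin done s0 ->
  parent_code (done s0) v (s xPV 0) -> s xV 0 = v -> s xt 0 = t ->
  (forall y l, y \in [:: xRow; xOrd] -> s y l = s0 y l) ->
  grow_inv s0 v s -> stuck s0 v s -> elim_inv t.+1 (run finish s).
Proof.
move=> inv vD [m_le m_edge m_par] sV st frO gi stk.
have [sR sZ oth fr an] := gi.
set s' := run finish s.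
(* The index [u] is a round in [xOrd] and a vertex elsewhere; [v] is recorded at round [t] with the
   stamp [t.+1], above all earlier stamps. *)
have E y (u : nat) : s' y u =
    if y == xOrd then if u == t then val v else s0 xOrd u
    else if u == v then
      if y == xAct then s xA 0 else if y == xSize then s xZ 0
      else if y == xPar then s xPV 0 else if y == xDone then t.+1 else s y u
    else s y u.
  rewrite /s' /finish !run_seq !run_put !evalE !updateE /= sV st.
  case: eqVneq => [->|?] /=; first by case: eqP => // _; rewrite frO.
  case: (eqVneq y xAct) => [->|?] //=; case: (eqVneq y xSize) => [->|?] //=.
  by case: (eqVneq y xPar) => [->|?] //=; case: (eqVneq y xDone) => [->|?] //=;
     case: ifP.
have row' (u : 'I_n) : row s' u = row s u.
  by apply: row_eq => w; rewrite E /=; case: ifP.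
have doneE : done s' = v |: done s0.
  apply/setP=> u; rewrite !inE E /= (inj_eq (@ord_inj n)) fr //.
  by case: (u == v).
have ne (u : 'I_n) : u \in done s0 -> u != v by move=> uD; apply: contraNneq vD => <-.
have nev (u : 'I_n) : u != v -> (val u == val v) = false by move=> uv; apply/negbTE.
have old y (u : 'I_n) : y \in [:: xDone; xPar; xAct; xSize] -> u != v -> s' y u = s0 y u.
  move=> yL uv; rewrite -fr // E (nev u uv).
  by move: yL; rewrite !inE => /or4P[]/eqP->.
have new : [/\ s' xDone v = t.+1, s' xPar v = s xPV 0, s' xAct v = s xA 0 & s' xSize v = s xZ 0].
  by rewrite !E /= eqxx.
have [vDone vPar vAct vSize] := new.
have ltn_t (u : 'I_n) : u \in done s0 -> (s0 xDone u).-1 < t.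
  by rewrite inE => du; have := inv_time inv u; lia.
split.
- by move=> u; rewrite E /= frO // (inv_row inv); case: ifP.
- rewrite doneE; apply: (cert_extend (inv_cert inv) vD); rewrite ?vDone ?vPar ?vAct ?row' //.
  + by move=> u /ne uv; rewrite old.
  + by move=> u /ne uv; rewrite old.
  + by move=> u /ne uv; rewrite old.
  + by move=> u /ne uv; rewrite row' oth.
  + by move=> u uD; rewrite ltnS (inv_time inv).
- rewrite doneE => u /setU1P[->|uD]; first by rewrite vSize row'.
  by rewrite old ?ne // row' oth ?ne // (inv_size inv).
- move=> u; rewrite doneE inE in_set1 negb_or => /andP[uv uD].
  by rewrite old // row' oth //; apply: (inv_fresh inv).
- by rewrite doneE cardsU1 vD (inv_card inv).
- move=> u; case: (eqVneq u v) => [->|uv]; first by rewrite vDone.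
  by rewrite old // leqW // (inv_time inv).
- move=> u; rewrite doneE => /setU1P[->|uD]; first by rewrite vDone E /= eqxx.
  rewrite old ?ne // E /= (inv_ord inv uD) ifN //; have := ltn_t u uD; lia.
- move=> i; rewrite ltnS leq_eqVlt => /orP[/eqP->|it]; first by exists v; rewrite // E /= eqxx.
  have [u u1 u2] := inv_ordV inv it; exists u; first by rewrite E /= ifN //; lia.
  by rewrite old //; apply: ne; rewrite inE u2.
Qed.

Lemma run_eliminate t s : acyclic G -> elim_inv t s -> s xt 0 = t -> t < n ->
  elim_inv t.+1 (run eliminate s).
Proof.
move=> acG inv st tn; rewrite /eliminate 5!run_seq.
set s1 := run find_leaf s; set s2 := run choose_alone s1.
set s3 := run choose_child s2; set s4 := run init_row s3; set s5 := run grow s4.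
have [v [s1V vD pc]] : exists v : 'I_n, [/\ s1 xV 0 = v, v \notin done s & parent_code (done s) v (s1 xPV 0)].
  (* Only [t < n] vertices are eliminated, so some vertex remains. *)
  apply/run_find_leaf/leaf_exists => //; apply: contraTneq tn => E.
  by rewrite -(inv_card inv) E cardsT card_ord ltnn.
have fr1 y l : y \notin writes find_leaf -> s1 y l = s y l by exact: run_frame.
have fr2 y l : y \notin writes choose_alone -> s2 y l = s1 y l by exact: run_frame.
have fr3 y l : y \notin writes choose_child -> s3 y l = s2 y l by exact: run_frame.
have fr4 y l : y \notin writes init_row -> s4 y l = s3 y l by exact: run_frame.
have fr5 y l : y \notin writes grow -> s5 y l = s4 y l by exact: run_frame.
have inv2 : elim_inv t s2.
  apply: (elim_inv_ext inv) => y l yL.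
  by rewrite /s2 (run_frame_in _ _ _ yL) // /s1 (run_frame_in _ _ _ yL).
have d2 : done s2 = done s by apply/setP=> w; rewrite !inE fr2 // fr1.
rewrite -d2 in vD pc.
have [BS2 BK2 alone2] := run_choose_alone s1V.
have s2V : s2 xV 0 = v by rewrite fr2.
have [alone3 child3 wit3] := run_choose_child inv2 s2V BS2 BK2 alone2.
have s3V : s3 xV 0 = v by rewrite fr3.
have [|R4 Z4 oth4 an4] := run_init_row inv2 vD _ s3V alone3 child3 wit3.
  by move=> y l; apply: run_frame_in.
have gi4 : grow_inv s2 v s4.
  split=> // y l yL.
  by rewrite /s4 (run_frame_in _ _ _ yL) // /s3 (run_frame_in _ _ _ yL).
have [gi5 stk] := run_grow inv2 gi4.
have s5PV : s5 xPV 0 = s1 xPV 0 by rewrite fr5 // fr4 // fr3 // fr2.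
have s5V : s5 xV 0 = v by rewrite fr5 // fr4.
have s5t : s5 xt 0 = t by rewrite fr5 // fr4 // fr3 // fr2 // fr1.
rewrite -s5PV in pc; apply: (run_finish inv2 vD pc s5V s5t _ gi5 stk).
by move=> y l; rewrite !inE => /orP[]/eqP->; rewrite fr5 // fr4 // fr3.
Qed.

Lemma run_eliminate_all s : acyclic G -> elim_inv 0 s ->
  elim_inv n (run eliminate_all s).
Proof.
move=> acG inv.
have ctr t s1 k : elim_inv t s1 -> elim_inv t (update s1 xt 0 k).
  move/elim_inv_ext; apply=> y l yL; rewrite update_neq //.
  by apply: contraTneq yL => ->.
apply: (run_for_players (I := elim_inv)) => //; first exact: ctr.
move=> t s' tn st _ inv'; apply: ctr; exact: (run_eliminate acG inv' st tn).
Qed.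

Lemma elim_inv_start s : (forall v : 'I_n, s xRow v = v * n) ->
  (forall y l, y \in [:: xDone; xPar; xMem] -> s y l = 0) -> elim_inv 0 s.
Proof.
move=> r z; have d0 : done s = set0 by apply/setP=> v; rewrite !inE z.
split=> //; rewrite ?d0 ?cards0 //.
- by split=> [v|v u|v u|v u|v|v]; rewrite in_set0.
- by move=> v; rewrite inE.
- by move=> v _; rewrite z //; split=> //; apply/setP=> w; rewrite !inE z.
- by move=> v; rewrite z.
- by move=> v; rewrite inE.
Qed.

(** * Labelling with distinct copies *)

Lemma run_equiv_test s (u : 'I_n) (a b : 'I_p) : s xu 0 = u -> s xk 0 = b ->
  s xAct u = a.+1 -> (run equiv_test s xOk 0 != 0) = equivalent G a b.
Proof.
move=> su sk sA; rewrite /equiv_test run_seq run_set evalE.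
rewrite (run_forall (F := fun i => [forall l : 'I_n, indiff G i (Some a, l.+1) (Some b, l.+1)])) //.
move=> i s' si fr.
rewrite (run_forall (F := fun l => indiff G i (Some a, l.+1) (Some b, l.+1))) //.
move=> l s2 sl fr2.
rewrite run_when !evalE sl !(fr2 xu, fr2 xk, fr2 xAct, fr2 xw) // si.
rewrite !(fr xu, fr xk, fr xAct) // !updateE /= su sk sA.
rewrite -[a.+1]/(encode (Some a)) -[b.+1]/(encode (Some b)) !prefers_queryE.
rewrite /alternative /= ltn_ord /= /indiff; case: (_ && _); by rewrite /= ?andbT ?andbF.
Qed.

Lemma run_find_copy s (u : 'I_n) (a : 'I_p) : s xu 0 = u -> s xAct u = a.+1 ->
  (exists2 b : 'I_p, equivalent G a b & s xUsed b = 0) ->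
  exists b : 'I_p, [/\ run find_copy s xC 0 = b.+1, equivalent G a b & s xUsed b = 0].
Proof.
move=> su sA [b0 eb0 ub0].
pose I k (s' : store) := (exists b : 'I_p, [/\ b < k, equivalent G a b & s xUsed b = 0]) ->
  exists b : 'I_p, [/\ s' xC 0 = b.+1, equivalent G a b & s xUsed b = 0].
suff : I p (run find_copy s) by apply; exists b0.
apply: (run_for_activities (I := I)) => //; first by case=> b [].
move=> k s' kp sk fr IH; pose b := Ordinal kp.
have ok : (run equiv_test s' xOk 0 != 0) = equivalent G a b.
  by apply: (@run_equiv_test _ u) => //; rewrite fr.
rewrite run_seq run_when; set s2 := run equiv_test s' in ok *.
have fr2 y l : y \notin writes equiv_test -> s2 y l = s' y l by exact: run_frame.
rewrite !evalE ok !fr2 // sk fr // negbK.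
case: ifP => [/andP[eb /eqP ub] _|no [c [ck ec uc]]].
  by exists b; rewrite run_set !updateE /= fr2 // sk addn1.
have [|d [Cd ed ud]] := IH; last by exists d; rewrite updateE /= fr2.
exists c; split=> //; move: ck; rewrite ltnS leq_eqVlt => /orP[/eqP ck|//].
by move: no; rewrite -ck uc eqxx andbT (_ : b = c) ?ec //; apply: val_inj.
Qed.

Definition labelled (k : nat) s : Prop :=
  [/\ forall v : 'I_n, s xAct v = 0 \/ k <= v -> s xLab v = 0,
      forall (v : 'I_n) (a : 'I_p), v < k -> s xAct v = a.+1 ->
        exists2 b : 'I_p, s xLab v = b.+1 & equivalent G a b,
      forall (v : 'I_n) (b : 'I_p), s xLab v = b.+1 -> s xUsed b != 0,
      forall v w : 'I_n, s xLab v != 0 -> s xLab v = s xLab w -> v = w &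
      #|[set b : 'I_p | s xUsed b != 0]| <= k].

Lemma run_label_all s : (forall a : 'I_p, copyable G a) ->
  (forall v : 'I_n, s xAct v <= p) ->
  (forall y l, y \in [:: xLab; xUsed] -> s y l = 0) ->
  labelled n (run label_all s).
Proof.
move=> cop A_le z; apply: (run_for_players (I := labelled)) => //.
  split=> [v _|v a //|v b|v w|]; rewrite ?updateE /= ?z //.
  by rewrite leqn0 cards_eq0; apply/eqP/setP=> b; rewrite !inE updateE /= z.
move=> k s' kn sk fr [l0 l1 l2 l3 l4]; pose u := Ordinal kn.
rewrite /labelled run_when !evalE sk; case: ifP => [Au|/negbFE/eqP Au]; last first.
  split=> //.
  - by move=> v [Av|kv]; apply: l0; [left | right; apply: ltnW].
  - move=> v a; rewrite ltnS leq_eqVlt => /orP[/eqP vk|]; last exact: l1.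
    by move: Au; rewrite !updateE /= vk => ->.
  - exact: leqW.
have [a Aa] : exists a : 'I_p, s' xAct u = a.+1.
  have : s' xAct u <= p by rewrite fr.
  by case: (s' xAct u) Au => // m _ mp; exists (Ordinal mp).
have [|b [Cb eb ub]] := run_find_copy (u := u) sk Aa.
  (* At most [k < n] copies are in use whereas the class of [a] has at least [n] elements: one is
     free. *)
  have /subsetPn[b] : ~~ ([set b | equivalent G a b] \subset [set b : 'I_p | s' xUsed b != 0]).
    apply: contraL (kn) => /subset_leq_card sub; rewrite -leqNgt.
    exact: leq_trans (cop a) (leq_trans sub l4).
  by rewrite !inE negbK => eb /eqP ub; exists b.
rewrite run_seq; set s2 := run find_copy s' in Cb *.
have fr2 y l : y \notin writes find_copy -> s2 y l = s' y l by exact: run_frame.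
set s3 := update _ _ _ _.
have E y l : y \in [:: xAct; xLab; xUsed] -> s3 y l =
    if (y == xLab) && (l == k) then b.+1 else
    if (y == xUsed) && (l == b) then 1 else s' y l.
  by rewrite /s3 run_seq !run_put !evalE !updateE /= Cb (fr2 xu) // sk !inE => /or3P[]/eqP-> /=;
     rewrite ?fr2.
have neqb (c : 'I_p) (v : 'I_n) : s' xLab v = c.+1 -> c != b.
  by move/l2; apply: contraNneq => ->; rewrite ub.
split.
- move=> v; rewrite !E //=; case: eqP => [->|_]; last first.
    by case=> h; apply: l0; [left | right; apply: ltnW].
  by case=> [vA|]; [rewrite -[k]/(val u) Aa in vA | rewrite ltnn].
- move=> v c; rewrite !E //= ltnS leq_eqVlt; case: eqP => [vk _|_ /= vk]; last exact: l1.
  by rewrite vk -[k]/(val u) Aa => -[/ord_inj<-]; exists b.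
- move=> v c; rewrite !E //=; case: eqP => [_ [/ord_inj<-]|_ /l2]; first by rewrite eqxx.
  by case: ifP.
- move=> v w; rewrite !E //=.
  case: (eqVneq (v : nat) k) => [vk|_]; case: (eqVneq (w : nat) k) => [wk|_].
  + by move=> _ _; apply: val_inj; rewrite /= vk wk.
  + by move=> _ /esym/neqb; rewrite eqxx.
  + by move=> _ /neqb; rewrite eqxx.
  + exact: l3.
apply: leq_trans (_ : #|b |: [set b : 'I_p | s' xUsed b != 0]| <= _).
  apply/subset_leq_card/subsetP=> c; rewrite !inE E //=.
  by case: (eqVneq (c : nat) b) => [/ord_inj->|_ ->]; rewrite ?eqxx ?orbT.
by rewrite cardsU1 inE ub.
Qed.

(** * The backward pass *)

Definition assigned (t : nat) s : Prop :=
  forall v : 'I_n, n < s xDone v + t ->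
    [/\ s xHead v < n, s xPar v = 0 -> s xHead v = v,
        forall u : 'I_n, s xPar v = u.+1 ->
          s xHead v = if v \in row s (s xHead u) then s xHead u else v &
        s xOut v = s xLab (s xHead v)].

Lemma run_assign_all s : elim_inv n s -> assigned n (run assign_all s).
Proof.
move=> inv; have dT v : v \in done s.
  suff -> : done s = setT by [].
  by apply/eqP; rewrite eqEcard subsetT cardsT card_ord (inv_card inv) leqnn.
(* [n < s xDone v + t] singles out the [t] vertices eliminated last; at the start there is none, as
   stamps are at most [n]. *)
apply: (run_for_players (I := assigned)) => //.
  by move=> v; rewrite updateE /= addn0 ltnNge (inv_time inv).
move=> t s' tn st fr IH.
have frL y l : y \in [:: xDone; xPar; xMem; xRow; xLab] -> s' y l = s y l.
  by rewrite !inE => /or4P[/eqP->|/eqP->|/eqP->|/orP[]/eqP->]; apply: fr.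
have rowE u : row s' u = row s u by apply: row_eq => w; rewrite frL.
have [|v Ov Dv] := inv_ordV inv (i := n.-1 - t); first by lia.
(* A parent is eliminated after its children, so the backward pass has treated it before them. *)
have later (v' u : 'I_n) : s xPar v' = u.+1 -> n <= s xDone v' + t -> n < s xDone u + t.
  by move=> Pv'; have := cert_rank (inv_cert inv) (dT v') (dT u) Pv'; lia.
have head_lt (u : 'I_n) : n < s xDone u + t -> s' xHead u < n.
  by move=> lt; case: (IH u) => //; rewrite frL.
(* The intended value of [xHead v], with the parent index [m] kept as a number, as in the
   program. *)
pose h := if s xPar v is m.+1 then
            if v \in row s (s' xHead m) then s' xHead m else v else val v.
rewrite /assign run_seq run_set !evalE eval_sub !evalE st fr // Ov.
rewrite run_seq run_set !evalE !updateE /=; set s1 := update _ xQ _ _.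
have fr1 y l : y \notin [:: xV; xQ] -> s1 y l = s' y l.
  by rewrite !inE negb_or => /andP[? ?]; rewrite /s1 !update_neq.
have s1V : s1 xV 0 = v by rewrite /s1 !updateE.
have s1Q : s1 xQ 0 = s' xHead (s xPar v).-1 by rewrite /s1 updateE /= (frL xPar).
rewrite run_seq; set s2 := run (CIf _ _ _) s1.
have s2E : s2 = update s1 xHead v h.
  rewrite /s2 run_if !evalE s1V s1Q !(fr1 xPar, fr1 xMem, fr1 xRow) //.
  rewrite !(frL xPar, frL xRow, frL xMem) // !run_put !evalE s1V s1Q /h.
  case Pv: (s xPar v) => [|m] //=.
  have mn : m < n by rewrite -Pv; apply: inv_bound inv.
  have hn : s' xHead m < n.
    by apply: (head_lt (Ordinal mn)); apply: (later v) => //; lia.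
  by rewrite (inv_row inv (Ordinal hn)) /= inE; case: ifP.
rewrite run_put !evalE s2E !updateE /= s1V eqxx (fr1 xLab) // (frL xLab) //.
set s3 := update _ xt _ _.
have row3 u : row s3 u = row s u.
  by rewrite -rowE; apply: row_eq => w; rewrite /s3 !updateE /= fr1.
have E y l : y \in [:: xDone; xPar; xLab] -> s3 y l = s y l.
  by move=> yL; rewrite -frL -?fr1 ?/s3 ?updateE; move: yL; rewrite !inE => /or3P[]/eqP->.
have headE l : s3 xHead l = if l == v then h else s' xHead l.
  by rewrite /s3 !updateE /= fr1.
have outE l : s3 xOut l = if l == v then s xLab h else s' xOut l.
  by rewrite /s3 !updateE /= fr1.
have up (v' u : 'I_n) : s xPar v' = u.+1 -> n <= s xDone v' + t -> s3 xHead u = s' xHead u.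
  move=> Pv' /(later _ _ Pv') lt; rewrite headE ifN //; apply: contraTneq lt => ->.
  by rewrite Dv; lia.
move=> w; rewrite !(E xDone, E xPar, E xLab) // => lt_w; rewrite headE outE.
case: (eqVneq (w : nat) v) => [/ord_inj wv|wv].
  rewrite wv; split=> //; rewrite /h.
  - case Pv: (s xPar v) => [|m]; first exact: ltn_ord.
    have mn : m < n by rewrite -Pv; apply: inv_bound inv.
    case: ifP => _ //; apply: (head_lt (Ordinal mn)); apply: (later v) => //; lia.
  - by move=> ->.
  - by move=> u Pv; rewrite (up v) ?Pv ?row3 //; lia.
(* Equality would give [w] the stamp handled in this round, and [xOrd] would identify [w] with
   [v]. *)
have {}lt_w : n < s xDone w + t.
  rewrite ltn_neqAle; apply/andP; split; last by rewrite -ltnS -addnS.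
  apply: contraNneq wv => E'; rewrite -Ov -(inv_ord inv (dT w)).
  by rewrite (_ : n.-1 - t = (s xDone w).-1) //; lia.
case: (IH w); rewrite !(frL xDone, frL xPar) // => h1 h2 h3 h4; split=> //.
  by move=> u Pw; rewrite (up w) ?(ltnW lt_w) // row3 -rowE; apply: h3.
by rewrite h4 (frL xLab).
Qed.

(** * Assembling the algorithm *)

Lemma run_solve : (forall a : 'I_p, copyable G a) -> acyclic G ->
  exists pi : assignment n p,
    [/\ forall i : 'I_n, run solve empty_store xOut i = encode (pi i),
        feasible G pi & individually_stable G pi].
Proof.
move=> cop acG; rewrite /solve 3!run_seq.
set s1 := run row_init _; set s2 := run eliminate_all s1.
set s3 := run label_all s2; set s4 := run assign_all s3.
have inv2 : elim_inv n s2.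
  apply: run_eliminate_all => //; apply: elim_inv_start => [v|y l yL].
    by apply: run_row_init => //; apply/ltnW/ltn_ord.
  by rewrite /s1 (run_frame_in _ _ _ yL).
have D2 : done s2 = setT.
  by apply/eqP; rewrite eqEcard subsetT cardsT card_ord (inv_card inv2) leqnn.
have A_le (v : 'I_n) : s2 xAct v <= p.
  have vD : v \in done s2 by rewrite D2 in_setT.
  have := anchored_valid (cert_anchored (inv_cert inv2) vD); rewrite validE.
  by case: (s2 xAct v) => // m /andP[].
have zero y l : y \in [:: xLab; xUsed] -> s2 y l = 0.
  by move=> yL; rewrite /s2 (run_frame_in _ _ _ yL) // /s1 (run_frame_in _ _ _ yL).
have [lab0 labS _ lab_inj _] := run_label_all cop A_le zero.
rewrite -/s3 in lab0 labS lab_inj.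
have inv3 : elim_inv n s3.
  by apply: (elim_inv_ext inv2) => y l yL; rewrite /s3 (run_frame_in _ _ _ yL).
have D3 : done s3 = setT by rewrite -D2; apply/setP=> v; rewrite !inE /s3 run_frame.
have fr4 y l : y \in [:: xDone; xPar; xMem; xLab] -> s4 y l = s3 y l.
  by move=> yL; rewrite /s4 (run_frame_in _ _ _ yL).
have row4 u : row s4 u = row s3 u by apply: row_eq => w; rewrite fr4.
have asg (v : 'I_n) := run_assign_all inv3 (v := v); rewrite -/s4 in asg.
have {}asg (v : 'I_n) : [/\ s4 xHead v < n, s3 xPar v = 0 -> s4 xHead v = v,
    forall u : 'I_n, s3 xPar v = u.+1 ->
      s4 xHead v = if v \in row s3 (s4 xHead u) then s4 xHead u else v &
    s4 xOut v = s3 xLab (s4 xHead v)].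
  have [|h1 h2 h3 h4] := asg v.
    have : v \in done s3 by rewrite D3 in_setT.
    by rewrite inE fr4 //; lia.
  rewrite !(fr4 xPar, fr4 xLab) // in h2 h3 h4; split=> //.
  by move=> u Pv; rewrite (h3 u Pv) row4.
pose L (v : 'I_n) : activity p := if s3 xLab v is b.+1 then insub b else None.
have labE (v : 'I_n) : s3 xLab v = encode (L v).
  case Av: (s3 xAct v) => [|a]; first by rewrite /L lab0 //; left.
  have ap : a < p by rewrite -Av /s3 run_frame.
  by have [b Lb _] := labS v (Ordinal ap) (ltn_ord v) Av; rewrite /L Lb valK.
(* The default [v] is never returned, as [s4 xHead v] is below [n]. *)
pose H (v : 'I_n) : 'I_n := insubd v (s4 xHead v).
have HE (v : 'I_n) : s4 xHead v = H v by rewrite insubdK //; case: (asg v).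
pose pi : assignment n p := [ffun v => L (H v)]; exists pi.
suff [fea sta] : feasible G pi /\ individually_stable G pi.
  by split=> // i; have [_ _ _ ->] := asg i; rewrite HE labE ffunE.
apply: (cert_stable (rk := fun v => s3 xDone v) (P := fun v => s3 xPar v)
  (S := fun v => row s3 v) (L := L) (H := H)).
(* The certificate was built with the original activities; the labels are copies of them. *)
- rewrite -D3; apply: cert_relabel (inv_cert inv3) => v i c k l.
  rewrite -labE; case Av: (s3 xAct v) => [|a]; first by rewrite lab0 //; left.
  have ap : a < p by rewrite -Av /s3 run_frame.
  have [b -> eb] := labS v (Ordinal ap) (ltn_ord v) Av.
  by rewrite -!(equivalent_prefers i c k l eb).
- by move=> v w a Lv Lw; apply: lab_inj; rewrite !labE Lv ?Lw.
- move=> v u Pv; apply: ord_inj; have [_ _ h3 _] := asg v; rewrite -HE (h3 u Pv) !HE.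
  by case: ifP.
- by move=> v P0; apply: ord_inj; have [_ h2 _ _] := asg v; rewrite -HE h2.
- by move=> v; rewrite ffunE.
Qed.

End Correctness.

Theorem theorem8 :
  (forall (n p : nat) (G : gGASP n p),
     (forall a : 'I_p, copyable G a) -> acyclic G ->
     exists pi : assignment n p, feasible G pi /\ individually_stable G pi)
  /\
  (exists (c : prog) (k d : nat),
     forall (n p : nat) (G : gGASP n p),
       (forall a : 'I_p, copyable G a) -> acyclic G ->
       exists (t : nat) (pi : assignment n p),
         [/\ computes G c t pi,
             t <= k * (n + p).+1 ^ d,
             feasible G pi &
             individually_stable G pi]).
Proof.
split=> [n p G cop acG|].
  by have [pi [_ fea sta]] := run_solve cop acG; exists pi.
have [k [d bnd]] := exec_run solve_ok.
exists (compile solve), k, d => n p G cop acG.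
have [pi [out fea sta]] := run_solve cop acG.
have [t ex t_le] := bnd n p G empty_store.
by exists t, pi; split=> //; exists (run G solve empty_store).
Qed.
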